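(* Let $\eta_t(\omega)$ be the random walk in random environment built from $\delta\in(0,1/2)$, $\alpha>0$ and the i.i.d. vectors $(\xi_i,Y_i)$ as described in the context. Suppose $\mathbb{E}[\zeta_1]=0$, $s^2\in(0,\infty)$, $\lambda>0$, $\sigma^2\in[0,\infty)$ and $\alpha\in(0,1/2)$. Then, for $\mathbb{P}$-a.e. $\omega$, for any $\varepsilon>0$, $P$-a.s., $$\eta_t(\omega)\le(1+\varepsilon)\left(\frac{1-\alpha}{\lambda}\right)^{1/(1-\alpha)}(\log t)^{1/(1-\alpha)}$$ for all but finitely many $t$, and $$\eta_t(\omega)\ge(1-\varepsilon)\left(\frac{1-\alpha}{\lambda}\right)^{1/(1-\alpha)}(\log t)^{1/(1-\alpha)}$$ for infinitely many $t$.
   Context: Environment. Fix $\delta\in(0,1/2)$ and $\alpha>0$. Let $(\xi_i,Y_i)$, $i\in\mathbb{N}=\{1,2,\dots\}$, be i.i.d. random vectors on a probability space $(\Omega,\mathcal{F},\mathbb{P})$ (with expectation $\mathbb{E}$ and variance $\mathrm{Var}$) such that $\mathbb{P}[\delta\le\xi_1\le 1-\delta]=1$ and $Y_1$ takes values in $[-1,1]$; $\xi_1$ and $Y_1$ may be dependent. Set $p_0=q_0=1/2$ and, for $n\ge1$, let $p_n$ be the truncation of $\xi_n+Y_nn^{-\alpha}$ to $[\delta/2,1-\delta/2]$, i.e. $p_n=\xi_n+Y_nn^{-\alpha}$ if this lies in $[\delta/2,1-\delta/2]$, $p_n=\delta/2$ if $\xi_n+Y_nn^{-\alpha}<\delta/2$,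 and $p_n=1-\delta/2$ if $\xi_n+Y_nn^{-\alpha}>1-\delta/2$; let $q_n=1-p_n$. The environment is $\omega=(p_0,p_1,p_2,\dots)$. Walk. Given $\omega$, $(\eta_t(\omega);t\in\mathbb{Z}^+)$, $\mathbb{Z}^+=\{0,1,2,\dots\}$, is the Markov chain on $\mathbb{Z}^+$ under the quenched probability $P$ (depending on $\omega$), with $\eta_0(\omega)=r$ for some fixed $r\in\mathbb{Z}^+$ and transition probabilities: from $n\ge1$, to $n-1$ with probability $p_n$ and to $n+1$ with probability $q_n$; from $0$, to $0$ with probability $p_0$ and to $1$ with probability $q_0$. Notation. $\zeta_n=\log\left(\frac{\xi_n}{1-\xi_n}\right)$, $Z_n=\frac{Y_n}{\xi_n(1-\xi_n)}$, $\lambda=\mathbb{E}[Z_1]$, $s^2=\mathrm{Var}[\xi_1]$, $\sigma^2=\mathrm{Var}[Y_1]$. *)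

(* Defs.v *)
From HB Require Import structures.
From mathcomp Require Import all_boot all_order all_algebra.
From mathcomp Require Import finmap.
From mathcomp Require Import all_classical all_reals all_analysis.

Set Implicit Arguments.
Unset Strict Implicit.
Unset Printing Implicit Defensive.

Import Order.TTheory GRing.Theory Num.Theory.
Import numFieldNormedType.Exports.

Local Open Scope classical_set_scope.
Local Open Scope ring_scope.

(* The sequence is indexed by {1, 2, ...}: the term X 0 is unconstrained. *)
Definition mutually_independent (d d' : measure_display)
    (T : measurableType d) (T' : measurableType d') (R : realType)
    (P : probability T R) (X : nat -> T -> T') : Prop :=
  forall (I : {fset nat}) (B : nat -> set T'),
    (forall i, i \in I -> (1 <= i)%N) ->
    (forall i, measurable (B i)) ->
    P (\bigcap_(i in [set` I]) (X i @^-1` B i)) =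
    (\prod_(i <- I) P (X i @^-1` B i))%E.

Definition identically_distributed (d d' : measure_display)
    (T : measurableType d) (T' : measurableType d') (R : realType)
    (P : probability T R) (X : nat -> T -> T') : Prop :=
  forall (i : nat) (B : set T'), (1 <= i)%N -> measurable B ->
    P (X i @^-1` B) = P (X 1%N @^-1` B).

Definition iid (d d' : measure_display)
    (T : measurableType d) (T' : measurableType d') (R : realType)
    (P : probability T R) (X : nat -> T -> T') : Prop :=
  mutually_independent P X /\ identically_distributed P X.

Definition truncate (R : realType) (a b u : R) : R :=
  if u < a then a else if b < u then b else u.

(* The environment p_0, p_1, p_2, ... associated with one realisation
   x_1, x_2, ... and y_1, y_2, ... of the two sequences. *)
Definition env (R : realType) (delta alpha : R) (x y : nat -> R) (n : nat) : R :=
  if n is 0%N then 2^-1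
  else truncate (delta / 2) (1 - delta / 2) (x n + y n * n%:R `^ (- alpha)).

Definition step_prob (R : realType) (p : nat -> R) (m n : nat) : R :=
  if m is m'.+1 then
    if n == m' then p m else if n == m.+1 then 1 - p m else 0
  else
    if n == 0%N then p 0%N else if n == 1%N then 1 - p 0%N else 0.

(* eta is a Markov chain from r with the transition probabilities above.  The
   Markov property is stated in product form, which avoids conditioning on
   histories of probability zero. *)
Definition quenched_walk (d : measure_display) (S : measurableType d)
    (R : realType) (Q : probability S R) (p : nat -> R) (r : nat)
    (eta : nat -> {RV Q >-> nat}) : Prop :=
  Q [set w | eta 0%N w = r] = 1%E /\
  forall (t : nat) (x : nat -> nat),
    Q [set w | forall k, (k <= t.+1)%N -> eta k w = x k] =
    (Q [set w | forall k, (k <= t)%N -> eta k w = x k]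
      * (step_prob p (x t) (x t.+1))%:E)%E.

Definition zeta (R : realType) (T : Type) (xi : nat -> T -> R) (n : nat) (w : T)
    : R := ln (xi n w / (1 - xi n w)).

Definition Zvar (R : realType) (T : Type) (xi Y : nat -> T -> R) (n : nat) (w : T)
    : R := Y n w / (xi n w * (1 - xi n w)).

Definition rate (R : realType) (alpha lambda : R) (t : nat) : R :=
  ((1 - alpha) / lambda) `^ (1 - alpha)^-1 * (ln t%:R) `^ (1 - alpha)^-1.

(* Main.v *)
(** Write [q = 1 - p], [b = 1 - alpha] and let [V n = sum_(1 <= k <= n) log (p_k / q_k)] be the
    potential of the environment. Expanding the logarithm to first order, [V n = sum (zeta_k
    + (Z_k - lambda) k^-alpha) + lambda n^b / b + O(n^(1 - 2 alpha))], and the centred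
    independent bounded sum is [o(n^b)] almost surely by Chernoff's bound and
    Borel-Cantelli, because [b > 1/2]. Hence [V n ~ c n^b] with [c = lambda / b], and only
    this asymptotics of the environment matters.
    Upper bound: the walk is reversible with weights [pi n = q_0 / (q_n exp (V n))], so [Q
    (eta t = n) <= pi n / pi r] at all times; hence [Q (c (eta t)^b > (1 + theta) log t)] is
    summable in [t].
    Lower bound: the function [g] vanishing at 0 with drift identically 1 has [g n <= exp
    ((1 + o(1)) c n^b)] and dominates the mean hitting time of [n]; by Markov's inequality
    and Borel-Cantelli, for all large [n] the level [n] is reached before time [exp ((1 +
    theta) c n^b)]. *)

Require Import Defs.
From HB Require Import structures.
From mathcomp Require Import all_boot all_order all_algebra.
From mathcomp Require Import finmap.
From mathcomp Require Import all_classical all_reals all_analysis.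
From mathcomp Require Import measurable_realfun.
From mathcomp Require Import ring lra zify.

Set Implicit Arguments.
Unset Strict Implicit.
Unset Printing Implicit Defensive.

Import Order.TTheory GRing.Theory Num.Theory.
Import numFieldNormedType.Exports.
Import HBNNSimple.

Local Open Scope classical_set_scope.
Local Open Scope ring_scope.

(** * Series and Borel-Cantelli *)

(** Comparison of the sum with an integral; the term at 0 vanishes, a power of 0 with nonzero
    exponent being 0. *)
Lemma sum_powRN_bound (R : realType) (g : R) (n : nat) : 0 < g ->
  \sum_(0 <= k < n.+1) (k%:R : R) `^ (- (1 + g)) <= 1 + g^-1.
Proof.
(* Subtracting the integral tail [g^-1 * (m+1)^-g] strengthens the claim enough for the induction to
   close. *)
move=> g0; suff H m : \sum_(0 <= k < m.+2) (k%:R : R) `^ (- (1 + g)) <=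
    1 + g^-1 - g^-1 * m.+1%:R `^ (- g).
  apply: (@le_trans _ _ (\sum_(0 <= k < n.+2) (k%:R : R) `^ (- (1 + g)))).
    by rewrite [leRHS]big_nat_recr//= lerDl powR_ge0.
  by apply: (le_trans (H n)); rewrite gerBl mulr_ge0 ?powR_ge0// invr_ge0 ltW.
elim: m => [|m IH].
  rewrite big_nat_recr//= big_nat1 powR1 powR0 ?oppr_eq0 ?gt_eqF//; first lra.
  by rewrite addr_gt0.
rewrite big_nat_recr//=; apply: (le_trans (lerD IH (lexx _))).
set x : R := m.+2%:R; have x0 : 0 < x by rewrite ltr0n.
have -> : m.+1%:R = x * (1 + - x^-1).
  by rewrite mulrDr mulr1 mulrN divff ?gt_eqF// /x -(natrB _ (isT : 1 <= m.+2)%N) subn1.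
have x1 : x^-1 < 1 by rewrite invf_lt1// ltr1n.
have y0 : 0 < 1 - x^-1 by rewrite subr_gt0.
rewrite powRM ?(ltW x0) ?(ltW y0)//.
(* Multiplied by [x^-g], this bounds the decrease of the tail [(x-1)^-g - x^-g] below by [g] times
   the new term. *)
have H : 1 + g * x^-1 <= (1 + - x^-1) `^ (- g).
  rewrite /powR gt_eqF//; apply: le_trans (expR_ge1Dx _).
  rewrite lerD2l mulNr lerNr -mulrN ler_pM2l//.
  by apply: le_ln1Dx; rewrite ltrN2.
have -> : x `^ (- (1 + g)) = x `^ (- g) * x^-1.
  rewrite opprD addrC powRD ?powR_inv1 ?(ltW x0)//.
  by rewrite (gt_eqF x0) implybT.
have := ler_wpM2l (powR_ge0 x (- g)) H.
have gi0 : 0 < g^-1 by rewrite invr_gt0.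
move/(ler_wpM2l (ltW gi0)); rewrite mulrDr mulr1 mulrDr.
rewrite (_ : g^-1 * (x `^ (- g) * (g * x^-1)) = x `^ (- g) * x^-1); last first.
  by field; rewrite gt_eqF//= gt_eqF.
clearbody x; lra.
Qed.

Lemma borel_cantelli_powR d (T : measurableType d) (R : realType)
    (mu : probability T R) (F : nat -> set T) (C g : R) :
  0 <= C -> 0 < g -> (forall n, measurable (F n)) ->
  (\forall n \near \oo, (mu (F n) <= (C * n%:R `^ (- (1 + g)))%:E)%E) ->
  {ae mu, forall x, \forall n \near \oo, ~ F n x}.
Proof.
move=> C0 g0 mF [N _ HN].
have F0 : mu (lim_sup_set F) = 0%E.
  apply: lim_sup_set_cvg0 => //.
  apply: (@le_lt_trans _ _ (N%:R + C * (1 + g^-1))%:E); last exact: ltry.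
  rewrite -[leLHS]/(limn _); apply: lime_le.
    by apply: is_cvg_nneseries => *; exact: measure_ge0.
  apply: nearW => n.
  apply: (@le_trans _ _ (\sum_(0 <= k < n.+1) (mu (F k)))%E).
    by rewrite [leRHS]big_nat_recr//= leeDl.
  (* The indicator of [k < N] pays for the finitely many initial events, whose probability is only
     known to be at most 1. *)
  apply: (@le_trans _ _ (\sum_(0 <= k < n.+1)
     (((k < N)%N%:R + C * k%:R `^ (- (1 + g))))%:E)%E).
    apply: lee_sum => k _; case: ltnP => kN /=.
      apply: le_trans (probability_le1 _ (mF k)) _.
      by rewrite lee_fin lerDl mulr_ge0 ?powR_ge0.
    by rewrite add0r; exact: HN.
  rewrite sumEFin lee_fin big_split/= lerD//.
    rewrite -natr_sum ler_nat.
    suff -> m : (\sum_(0 <= k < m) (k < N)%N = minn m N)%N by exact: geq_minr.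
    elim: m => [|m IH]; first by rewrite big_geq// min0n.
    by rewrite big_nat_recr//= IH; lia.
  by rewrite -mulr_sumr ler_wpM2l// sum_powRN_bound.
exists (lim_sup_set F); split => //.
  by apply: bigcap_measurable => // k _; apply: bigcup_measurable => j _.
move=> x /= H n _; apply: contrapT => Hn; apply: H.
by exists n => // m nm Fm; apply: Hn; exists m.
Qed.

Lemma near_powR_ge (R : realType) (b A : R) : 0 < b ->
  \forall n \near \oo, A <= (n%:R : R) `^ b.
Proof.
move=> b0; have [A0|A0] := leP A 0.
  by apply: nearW => n; rewrite (le_trans A0)// powR_ge0.
near=> n.
rewrite -[A in leLHS]powRr1 ?(ltW A0)// -[in leLHS](mulVf (lt0r_neq0 b0)) powRrM.
apply: ge0_ler_powR; rewrite ?nnegrE ?powR_ge0 ?(ltW b0)//.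
by near: n; exact: nbhs_infty_ger.
Unshelve. all: by end_near. Qed.

(** With [y = n^(b/2)], the logarithm is [(2/b) * ln y <= (2/b) * y], while the right-hand side is
    quadratic in [y]. *)
Lemma near_ln_le_powR (R : realType) (a b C M : R) : 0 < a -> 0 < b ->
  \forall n \near \oo, C + M * ln (n%:R : R) <= a * n%:R `^ b.
Proof.
move=> a0 b0; have b20 : 0 < b / 2 by rewrite divr_gt0.
near=> n.
have n1 : 1 <= (n%:R : R) by near: n; exact: nbhs_infty_ger.
set y := (n%:R : R) `^ (b / 2).
have y0 : 0 < y by rewrite powR_gt0// (lt_le_trans ltr01).
have -> : n%:R `^ b = y * y.
  by rewrite -powRD -?splitr// (gt_eqF b0).
have -> : ln (n%:R : R) = (b / 2)^-1 * ln y.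
  by rewrite /y ln_powR mulKf// gt_eqF.
have lny : ln y <= y by rewrite ltW// ln_sublinear.
have yM : (a^-1 * (`|M| * (b / 2)^-1 + `|C|)) + 1 <= y.
  by rewrite /y; near: n; apply: near_powR_ge.
have y1 : 1 <= y.
  by apply: le_trans yM; rewrite lerDr mulr_ge0 ?invr_ge0 ?(ltW a0)// addr_ge0// mulr_ge0 ?invr_ge0 ?(ltW b20).
have lny0 : 0 <= ln y by rewrite ln_ge0.
have yM' : `|M| * (b / 2)^-1 + `|C| <= a * y.
  rewrite -ler_pdivrMl//; apply: le_trans yM; lra.
have H1 : M * ((b / 2)^-1 * ln y) <= `|M| * (b / 2)^-1 * y.
  rewrite mulrA; apply: (@le_trans _ _ (`|M| * (b / 2)^-1 * ln y)).
    by rewrite ler_wpM2r// ler_wpM2r ?invr_ge0 ?(ltW b20)// ler_norm.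
  by rewrite ler_wpM2l// mulr_ge0 ?invr_ge0 ?(ltW b20).
have H2 : C <= `|C| * y.
  by apply: (le_trans (ler_norm C)); rewrite ler_peMr.
have := ler_wpM2r (ltW y0) yM'; rewrite mulrDl -mulrA; lra.
Unshelve. all: by end_near. Qed.

(** The finitely many exceptional indices are absorbed in the constant, which adds up their ratios
    [|u k| / v k]. *)
Lemma near_le_bound (R : realType) (u v : nat -> R) :
  (forall n, (0 < n)%N -> 0 < v n) -> (\forall n \near \oo, u n <= v n) ->
  exists2 C : R, 0 <= C & forall n, (0 < n)%N -> u n <= C * v n.
Proof.
move=> v0 [N _ HN]; pose C := 1 + \sum_(1 <= k < N) `|u k| / v k.
have S0 (P : pred nat) : 0 <= \sum_(1 <= k < N | P k) `|u k| / v k.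
  rewrite big_nat_cond sumr_ge0// => k /andP[/andP[k0 _] _].
  by rewrite mulr_ge0// invr_ge0 ltW ?v0.
exists C => [|n n0]; first by rewrite addr_ge0 ?S0.
case: (leqP N n) => nN.
  by apply: (le_trans (HN _ nN)); rewrite ler_peMl ?(ltW (v0 _ n0))// lerDl S0.
rewrite -ler_pdivrMr ?v0//; apply: (@le_trans _ _ (`|u n| / v n)).
  by rewrite ler_wpM2r ?ler_norm// invr_ge0 ltW ?v0.
rewrite /C (bigD1_seq n) ?mem_index_iota ?iota_uniq ?n0//=.
by have := S0 (fun k => k != n); lra.
Qed.

Lemma ae_forall_nat d (T : measurableType d) (R : realType)
    (mu : {measure set T -> \bar R}) (A : nat -> T -> Prop) :
  (forall n, {ae mu, forall x, A n x}) -> {ae mu, forall x, forall n, A n x}.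
Proof.
move=> H; have := negligible_bigcup H; apply: negligibleS => x /= nA.
by have /existsNP[n nAn] := nA; exists n.
Qed.

(** * The quenched chain *)

Lemma nneseries_finite (R : realType) (f : nat -> \bar R) (N : nat) :
  (forall i, (N <= i)%N -> f i = 0%E) ->
  (\sum_(i <oo) f i = \sum_(0 <= i < N) f i)%E.
Proof.
move=> f0; apply: lim_near_cst => //; exists N => // n /= Nn.
rewrite (big_cat_nat (leq0n N) Nn)//= [X in (_ + X)%E](_ : _ = 0%E) ?adde0//.
by rewrite big_nat_cond big1// => i /andP[/andP[Ni _] _]; exact: f0.
Qed.

Lemma measure_nat_partition d (S : measurableType d) (R : realType)
    (Q : probability S R) (f : {RV Q >-> nat}) (A : set S) : measurable A ->
  (Q A = \sum_(i <oo) Q (A `&` [set w | f w = i]))%E.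
Proof.
move=> mA; have mf i : measurable [set w | f w = i].
  by apply: (@measurable_funPTI _ _ _ _ f [set i]).
have -> : A = \bigcup_i (A `&` [set w | f w = i]).
  by apply/seteqP; split => [w Aw|w [i _ []//]]; exists (f w).
rewrite measure_bigcup//=; last by move=> i j _ _ [w [[_ /= <-] [_ /= <-]]].
  rewrite -(@eq_eseriesl _ xpredT); last by move=> i; rewrite in_setT.
  apply: eq_eseriesr => i _; congr (Q _); apply/seteqP; split => w /=.
    by move=> [Aw fi]; split => //; exists i.
  by move=> [[k _ []]].
by move=> i _; exact: measurableI.
Qed.

(** At [j = 0] the convention [0.-1 = 0] makes the first term the holding step at the origin, so one
    formula serves all sites. *)
Lemma step_sum (R : realType) (p h : nat -> R) (j N : nat) : (j.+1 < N)%N ->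
  \sum_(0 <= i < N) step_prob p j i * h i =
  p j * h j.-1 + (1 - p j) * h j.+1.
Proof.
have delta a x : (a < N)%N -> \sum_(0 <= i < N) (if i == a then x else 0) * h i = x * h a.
  move=> aN; rewrite (bigD1_seq a) ?mem_index_iota ?iota_uniq//= eqxx big1 ?addr0//.
  by move=> i /negPf ->; rewrite mul0r.
move=> jN; have j1N : (j.-1 < N)%N by lia.
rewrite -(delta j.-1)// -(delta j.+1)// -big_split/=; apply: eq_bigr => i _.
rewrite -mulrDl; congr (_ * _); case: j {jN j1N} => [|j] /=.
  by case: eqP => [->|_]; rewrite ?addr0 ?add0r.
by case: eqP => [->|_]; rewrite ?add0r// ifF ?addr0//; apply/negbTE; lia.
Qed.

Lemma step_prob_ge0 (R : realType) (p : nat -> R) : (forall n, 0 <= p n <= 1) ->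
  forall i j, 0 <= step_prob p i j.
Proof.
move=> p01 [|i] j; rewrite /step_prob; have /andP[? ?] := p01 0%N.
  by case: eqP => // _; case: eqP => // _; rewrite subr_ge0.
by have /andP[? ?] := p01 i.+1; case: eqP => // _; case: eqP => // _; rewrite subr_ge0.
Qed.

Section walk.
Context d (S : measurableType d) (R : realType) (Q : probability S R).
Variables (p : nat -> R) (r : nat) (eta : nat -> {RV Q >-> nat}).
Hypothesis walk : quenched_walk p r eta.
Hypothesis p01 : forall n, 0 < p n < 1.

Let step0 i j : 0 <= step_prob p i j.
Proof. by apply: step_prob_ge0 => n; have /andP[/ltW-> /ltW->] := p01 n. Qed.

Lemma measurable_eta t (B : set nat) : measurable [set w | B (eta t w)].
Proof. exact: (@measurable_funPTI _ _ _ _ (eta t) B). Qed.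

Lemma measurable_cylinder (B : nat -> set nat) t :
  measurable [set w | forall s, (s < t)%N -> B s (eta s w)].
Proof.
rewrite (_ : [set _ | _] = \bigcap_(s in [set s | (s < t)%N]) [set w | B s (eta s w)]).
  by apply: bigcap_measurableType => s _; exact: measurable_eta.
by apply/seteqP; split => w /=.
Qed.

(* The cylinder is freed from singletons one coordinate at a time: [k] counts the free ones. *)
Lemma markov_cylinder k t (B : nat -> set nat) (x : nat -> nat) : (k <= t)%N ->
  (forall s, (k <= s)%N -> B s = [set x s]) ->
  (Q [set w | forall s, (s < t.+2)%N -> B s (eta s w)] =
   Q [set w | forall s, (s < t.+1)%N -> B s (eta s w)]
   * (step_prob p (x t) (x t.+1))%:E)%E.
Proof.
elim: k B x => [|k IH] B x kt Bx.
  have E u : [set w | forall s, (s < u.+1)%N -> B s (eta s w)] =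
      [set w | forall s, (s <= u)%N -> eta s w = x s].
    by apply/seteqP; split => w /= H s su; have := H s su; rewrite Bx.
  by rewrite !E; exact: (walk.2).
(* Coordinate [k] is pinned to a value [y], so that the induction hypothesis applies; summing over
   [y] frees it again. *)
pose B' y s := if s == k then B k `&` [set y] else B s.
have E u y : (k < u)%N -> [set w | forall s, (s < u)%N -> B s (eta s w)] `&` [set w | eta k w = y]
   = [set w | forall s, (s < u)%N -> B' y s (eta s w)].
  move=> ku; apply/seteqP; split => w /=.
    by move=> [H1 H2] s su; rewrite /B'; case: eqP => [sk|_]; [subst s; split => //; exact: H1|exact: H1].
  move=> H; split; last by have := H k ku; rewrite /B' eqxx => -[].
  by move=> s su; have := H s su; rewrite /B'; case: eqP => [->[]|].
rewrite (measure_nat_partition (eta k))//; last exact: measurable_cylinder.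
rewrite [in RHS](measure_nat_partition (eta k))//; last exact: measurable_cylinder.
rewrite muleC -nneseriesZl//; apply: eq_eseriesr => y _.
rewrite !E; [|lia|lia]; rewrite muleC.
have [Bky|nBky] := pselect (B k y).
  pose x' s := if s == k then y else x s.
  have -> : step_prob p (x t) (x t.+1) = step_prob p (x' t) (x' t.+1).
    by rewrite /x' !ifF//; apply/negbTE; lia.
  apply: IH; first lia.
  move=> s ks; rewrite /B' /x'; case: eqP => [_|/eqP sk].
    by apply/seteqP; split => z /=; [case|move=> ->].
  by apply: Bx; lia.
have E0 u : (k < u)%N -> [set w | forall s, (s < u)%N -> B' y s (eta s w)] = set0.
  move=> ku; apply/seteqP; split => w //= H; have := H k ku.
  by rewrite /B' eqxx => -[Bk ky]; apply: nBky; rewrite -ky.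
by rewrite !E0; [rewrite measure0 mul0e|lia|lia].
Qed.

(** The past is an event of product form: no constraint for the occupation bound, staying below a
    level for the hitting time. *)
Lemma markov_step (B : nat -> set nat) t i j :
  (Q ([set w | forall s, (s < t)%N -> B s (eta s w)] `&`
      [set w | eta t w = i] `&` [set w | eta t.+1 w = j]) =
   Q ([set w | forall s, (s < t)%N -> B s (eta s w)] `&` [set w | eta t w = i])
   * (step_prob p i j)%:E)%E.
Proof.
pose x s := if s == t then i else j.
(* Coordinates [t] and [t+1] are pinned to [i] and [j], which is the situation of [markov_cylinder]
   with [t] free coordinates. *)
pose B' s := if (s < t)%N then B s else [set x s].
have <- : [set w | forall s, (s < t.+1)%N -> B' s (eta s w)] =
    [set w | forall s, (s < t)%N -> B s (eta s w)] `&` [set w | eta t w = i].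
  apply/seteqP; split => w /=.
    move=> H; split; first by move=> s st; have := H s (ltnW st); rewrite /B' st.
    by have := H t (leqnn _); rewrite /B' ltnn /x eqxx.
  move=> [H1 H2] s st; rewrite /B'; case: ltnP => ts; first exact: H1.
  by rewrite (_ : s = t) /x ?eqxx//; lia.
have <- : [set w | forall s, (s < t.+2)%N -> B' s (eta s w)] =
    [set w | forall s, (s < t.+1)%N -> B' s (eta s w)] `&` [set w | eta t.+1 w = j].
  apply/seteqP; split => w /=.
    move=> H; split; first by move=> s st; exact: (H s (ltnW st)).
    by have := H t.+1 (leqnn _); rewrite /B' /x ltnNge leqnSn/= ifF//; apply/negbTE; lia.
  move=> [H1 H2] s st; case: (ltnP s t.+1) => ts; first exact: H1.
  by rewrite (_ : s = t.+1) /B' /x ?ltnNge ?leqnSn//= ?ifF//; [apply/negbTE|]; lia.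
have := @markov_cylinder t t B' x (leqnn _).
have -> : x t = i by rewrite /x eqxx.
have -> : x t.+1 = j by rewrite /x ifF//; apply/negbTE; lia.
by apply => s ts; rewrite /B' ltnNge ts.
Qed.

(* Reversibility: [pi r * P^t(r, j) = pi j * P^t(j, r) <= pi j]. *)
Lemma occupation_bound (pi : nat -> R) t j : (forall n, 0 < pi n) ->
  (forall i j, pi i * step_prob p i j = pi j * step_prob p j i) ->
  (Q [set w | eta t w = j] <= (pi j / pi r)%:E)%E.
Proof.
move=> pi0 rev; elim: t j => [|t IH] j.
  have [->|/eqP jr] := eqVneq j r.
    by rewrite divff ?gt_eqF// probability_le1//; exact: (measurable_eta _ [set r]).
  apply: (@le_trans _ _ 0%E); last by rewrite lee_fin divr_ge0 ?ltW.
  rewrite -(@subee _ 1%E)// -{2}(walk.1) -probability_setC; last exact: (measurable_eta _ [set r]).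
  apply: le_measure; rewrite ?inE.
  - exact: (measurable_eta _ [set j]).
  - by apply: measurableC; exact: (measurable_eta _ [set r]).
  - by move=> w /= -> .
rewrite (measure_nat_partition (eta t)); last exact: (measurable_eta _ [set j]).
apply: (@le_trans _ _ (\sum_(i <oo) (pi i / pi r * step_prob p i j)%:E)%E).
  apply: lee_nneseries => [i _ _|i _]; first exact: measure_ge0.
  have := markov_step (fun=> setT) t i j.
  rewrite (_ : [set w | forall s, _] = setT); last by apply/seteqP; split.
  rewrite !setTI [in X in _ -> X]setIC => ->; rewrite EFinM lee_wpmul2r ?lee_fin//.
(* Only neighbours of [j], or [j] itself at the origin, can jump to [j], so the series over the
   previous site stops before [j+2]. *)
rewrite (@nneseries_finite _ _ j.+2); last first.
  move=> i ij; rewrite mulrAC rev /step_prob; case: j ij {IH} => [|j] ij.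
    by case: eqP => [|_]; [lia|case: eqP => [|_]; [lia|rewrite mulr0 mul0r]].
  by case: eqP => [|_]; [lia|case: eqP => [|_]; [lia|rewrite mulr0 mul0r]].
rewrite sumEFin lee_fin.
under eq_bigr => i _ do rewrite mulrAC rev mulrAC.
rewrite -mulr_sumr (_ : \sum_(_ <= _ < _) _ = 1) ?mulr1//.
(* After the reversal the sum runs over a row of the transition matrix, whose total mass is 1. *)
have := @step_sum _ p (fun=> 1) j j.+2 (leqnn _).
by under eq_bigr do rewrite mulr1; move=> ->; ring.
Qed.

(* [g (eta t) - t] is a martingale, so the hitting time of [n], capped at [t + 1], has mean
   at most [g n - g 0]. *)
Lemma hitting_time_bound (g : nat -> R) n t : {homo g : i j / (i <= j)%N >-> i <= j} ->
  (forall i, p i * g i.-1 + (1 - p i) * g i.+1 = g i + 1) ->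
  (Q [set w | forall s, (s < t.+1)%N -> (eta s w < n)%N] <= ((g n - g 0%N) / t.+1%:R)%:E)%E.
Proof.
move=> gmono drift.
pose surv u := [set w | forall s, (s < u)%N -> (eta s w < n)%N].
have msurv u : measurable (surv u) by exact: (measurable_cylinder (fun=> [set k | (k < n)%N])).
have mE u i : measurable [set w | eta u w = i] by exact: (measurable_eta _ [set i]).
(* Mass at site [i] at time [u] of the walk killed on leaving [[0, n)]: the constraint concerns the
   times before [u] only. *)
pose b u i : R := fine (Q (surv u `&` [set w | eta u w = i])).
have bE u i : (Q (surv u `&` [set w | eta u w = i]) = (b u i)%:E)%E.
  by rewrite fineK// fin_num_measure//; exact: measurableI.
have b0 u i : 0 <= b u i by rewrite fine_ge0.
have survS u i : (i < n)%N ->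
    surv u.+1 `&` [set w | eta u w = i] = surv u `&` [set w | eta u w = i].
  move=> ni; apply/seteqP; split => w /= [H1 H2]; split => // s su.
    by apply: H1; lia.
  by have [->|su'] := eqVneq s u; [rewrite H2|apply: H1; lia].
have split u A : measurable A ->
    (Q (surv u.+1 `&` A) = \sum_(0 <= i < n) Q (surv u `&` [set w | eta u w = i] `&` A))%E.
  move=> mA; rewrite (measure_nat_partition (eta u)); last exact: measurableI.
  rewrite (@nneseries_finite _ _ n).
    rewrite big_nat_cond [in RHS]big_nat_cond; apply: eq_bigr => i /andP[/andP[_ ni] _].
    by rewrite -(survS u i ni); congr (Q _); apply/seteqP; split => w /= [[? ?] ?].
  move=> i ni; rewrite (_ : _ `&` _ = set0) ?measure0//.
  by apply/seteqP; split => w //= [[H _] H2]; have := H u (leqnn _); rewrite H2 ltnNge ni.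
have bS u j : b u.+1 j = \sum_(0 <= i < n) b u i * step_prob p i j.
  apply: EFin_inj; rewrite -bE split// -sumEFin; apply: eq_bigr => i _.
  by rewrite (markov_step (fun=> [set k | (k < n)%N])) EFinM bE.
have survE u : (Q (surv u.+1) = (\sum_(0 <= i < n) b u i)%:E)%E.
  rewrite -[surv _]setIT split// -sumEFin; apply: eq_bigr => i _.
  by rewrite setIT bE.
(* As [h n = 0], the killed mass contributes nothing, and the mean [a u] of [h] loses exactly the
   surviving mass at each step. *)
pose h i := g n - g i.
have h0 i : (i <= n)%N -> 0 <= h i by move=> ni; rewrite subr_ge0 gmono.
pose a u := \sum_(0 <= i < n) b u i * h i.
have a0 u : 0 <= a u.
  rewrite /a big_nat_cond sumr_ge0// => i /andP[/andP[_ ni] _].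
  by rewrite mulr_ge0// h0// ltnW.
have aS u : a u.+1 = a u - \sum_(0 <= i < n) b u i.
  rewrite /a; under eq_bigr do rewrite bS mulr_suml.
  rewrite exchange_big/= -sumrB; apply: eq_big_nat => i /andP[_ ni].
  under eq_bigr do rewrite -mulrA.
  rewrite -mulr_sumr -[X in _ - X]mulr1 -mulrBr; congr (_ * _).
  (* The sum is extended to the site [n], where [h] vanishes, so that both neighbours of [i] are in
     range. *)
  have := step_sum p h (ni : (i.+1 < n.+1)%N).
  rewrite big_nat_recr//= {2}/h subrr mulr0 addr0 => ->.
  by rewrite /h !mulrBr; have := drift i; lra.
have sumb u : \sum_(0 <= i < n) b u i <= 1.
  by rewrite -lee_fin -survE; apply: probability_le1.
have a0le : a 0%N <= g n - g 0%N.
  apply: (@le_trans _ _ (\sum_(0 <= i < n) b 0%N i * (g n - g 0%N))).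
    apply: ler_sum => i _; rewrite ler_wpM2l// lerB// gmono//.
  rewrite -mulr_suml ler_piMl// subr_ge0 gmono//.
have dec u : \sum_(0 <= i < n) b u.+1 i <= \sum_(0 <= i < n) b u i.
  rewrite -lee_fin -!survE; apply: le_measure; rewrite ?inE//.
  by move=> w H s su; apply: H; lia.
have tele u : a 0%N = a u + \sum_(0 <= s < u) \sum_(0 <= i < n) b s i.
  elim: u => [|u IH]; first by rewrite big_geq// addr0.
  by rewrite big_nat_recr//= aS IH; ring.
rewrite -/(surv _) survE lee_fin ler_pdivlMr ?ltr0n//.
apply: le_trans a0le; rewrite (tele t.+1).
have decs s u : (s <= u)%N -> \sum_(0 <= i < n) b u i <= \sum_(0 <= i < n) b s i.
  by move=> /subnK <-; elim: (u - s)%N => [|m IH] //; exact: le_trans (dec _) IH.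
(* Survival probabilities decrease in time, so [t+1] copies of the last one are at most their
   telescoped sum. *)
apply: (@le_trans _ _ (\sum_(0 <= s < t.+1) \sum_(0 <= i < n) b t i)).
  by rewrite big_const_nat subn0 iter_addr_0 mulr_natr.
apply: ler_wpDl => //.
by apply: ler_sum_nat => s /andP[_ st]; apply: decs; lia.
Qed.

End walk.

(** * Potential of the environment *)

Lemma nneseries_powR_le (R : realType) (C g : R) : 0 <= C -> 0 < g ->
  (\sum_(i <oo) (C * i%:R `^ (- (1 + g)))%:E <= (C * (1 + g^-1))%:E)%E.
Proof.
move=> C0 g0; have H0 i : (0 <= (C * i%:R `^ (- (1 + g)))%:E)%E.
  by rewrite lee_fin mulr_ge0 ?powR_ge0.
apply: lime_le; first exact: is_cvg_nneseries.
apply: nearW => n; apply: (@le_trans _ _ (\sum_(0 <= i < n.+1) (C * i%:R `^ (- (1 + g)))%:E)%E).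
  by rewrite [leRHS]big_nat_recr//= leeDl.
by rewrite sumEFin lee_fin -mulr_sumr ler_wpM2l// sum_powRN_bound.
Qed.

Section potential.
Context (R : realType) (p : nat -> R).
Hypothesis p01 : forall n, 0 < p n < 1.

(* The exponential of the potential [sum_(k <= n) log (p_k / q_k)] of the environment. *)
Definition odds_prod (n : nat) : R := \prod_(1 <= k < n.+1) (p k / (1 - p k)).

Definition reversible_weight (n : nat) : R := (1 - p 0%N) / ((1 - p n) * odds_prod n).

(* Solution [D] of [q_k D_k = 1 + p_k D_(k-1)], [q_0 D_0 = 1]. *)
Definition hitting_increment (k : nat) : R :=
  odds_prod k * ((1 - p 0%N)^-1 + \sum_(1 <= j < k.+1) ((1 - p j) * odds_prod j)^-1).

(** Mean time to reach [n] from the origin; [hitting_increment k] is the mean passage time from [k]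
    to [k+1]. *)
Definition hitting_potential (n : nat) : R := \sum_(0 <= k < n) hitting_increment k.

Let p0 n : 0 < p n. Proof. by have /andP[] := p01 n. Qed.
Let q0 n : 0 < 1 - p n. Proof. by have /andP[_] := p01 n; rewrite subr_gt0. Qed.

Lemma odds_prod_gt0 n : 0 < odds_prod n.
Proof. by apply: prodr_gt0 => k _; rewrite divr_gt0. Qed.

Lemma odds_prod0 : odds_prod 0%N = 1.
Proof. by rewrite /odds_prod big_geq. Qed.

Lemma odds_prodS n : odds_prod n.+1 = odds_prod n * (p n.+1 / (1 - p n.+1)).
Proof. by rewrite /odds_prod big_nat_recr. Qed.

Lemma reversible_weight_gt0 n : 0 < reversible_weight n.
Proof. by rewrite divr_gt0// mulr_gt0// odds_prod_gt0. Qed.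

(** Across the edge from [n] to [n+1] both flows equal the conductance [q_0 / odds_prod n]; distinct
    non-neighbours give 0 on both sides. *)
Lemma detailed_balance i j :
  reversible_weight i * step_prob p i j = reversible_weight j * step_prob p j i.
Proof.
have edge n : reversible_weight n * (1 - p n) = reversible_weight n.+1 * p n.+1.
  rewrite /reversible_weight odds_prodS; field.
  by rewrite !gt_eqF ?odds_prod_gt0.
have up n : step_prob p n n.+1 = 1 - p n.
  by case: n => [|n] //=; rewrite ifF ?eqxx//; apply/negbTE; lia.
have down n : step_prob p n.+1 n = p n.+1 by rewrite /= eqxx.
have far m n : m != n -> m != n.+1 -> n != m.+1 -> step_prob p m n = 0.
  by case: m => [|m] /=; [case: n => [|[|n]]|move=> *; rewrite !ifF//; apply/negbTE; lia].
have [->//|ij] := eqVneq i j.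
have [->|ij1] := eqVneq i j.+1; first by rewrite up down edge.
have [->|ij2] := eqVneq j i.+1; first by rewrite up down edge.
by rewrite !far ?mulr0// eq_sym.
Qed.

Lemma hitting_increment_ge0 k : 0 <= hitting_increment k.
Proof.
rewrite mulr_ge0 ?(ltW (odds_prod_gt0 _))// addr_ge0 ?invr_ge0 ?(ltW (q0 _))//.
by apply: sumr_ge0 => j _; rewrite invr_ge0 mulr_ge0 ?(ltW (q0 _)) ?(ltW (odds_prod_gt0 _)).
Qed.

Lemma hitting_potential_homo :
  {homo hitting_potential : i j / (i <= j)%N >-> i <= j}.
Proof.
move=> i j ij; rewrite /hitting_potential (big_cat_nat (leq0n i) ij)/= lerDl.
by apply: sumr_ge0 => k _; exact: hitting_increment_ge0.
Qed.

Lemma hitting_potential_drift i :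
  p i * hitting_potential i.-1 + (1 - p i) * hitting_potential i.+1 =
  hitting_potential i + 1.
Proof.
have gS n : hitting_potential n.+1 = hitting_potential n + hitting_increment n.
  by rewrite /hitting_potential big_nat_recr.
case: i => [|i] /=.
  rewrite gS /hitting_potential big_geq// /hitting_increment big_geq// odds_prod0.
  by field; rewrite gt_eqF.
(* Unit drift of the potential is equivalent to this recursion for its increments. *)
suff H : (1 - p i.+1) * hitting_increment i.+1 = p i.+1 * hitting_increment i + 1.
  by rewrite [hitting_potential i.+2]gS mulrDr H gS; ring.
rewrite /hitting_increment [in LHS]big_nat_recr//= odds_prodS.
set s := \sum_(_ <= _ < _) _.
by field; rewrite !gt_eqF// ?odds_prod_gt0.
Qed.

End potential.

(** * Bounds on reversible weights and mean hitting times *)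

Section asymptotics.
Context (R : realType) (p : nat -> R) (kappa b c : R).
Hypothesis kappa0 : 0 < kappa.
Hypothesis p0 : forall n, 0 < p n.
Hypothesis pkappa : forall n, p n <= 1 - kappa.
Hypothesis b0 : 0 < b.
Hypothesis c0 : 0 < c.
Hypothesis ln_odds_prod : forall e : R, 0 < e ->
  \forall n \near \oo, `|ln (odds_prod p n) - c * n%:R `^ b| <= e * n%:R `^ b.

Lemma p_lt1 n : 0 < p n < 1.
Proof. by rewrite p0 (le_lt_trans (pkappa n))// gtrBl. Qed.

Let W := odds_prod p.
Let W0 n : 0 < W n. Proof. exact: odds_prod_gt0 p_lt1 n. Qed.
Let qkappa n : kappa <= 1 - p n. Proof. by have := pkappa n; lra. Qed.

(** The margin [1 - a] in the exponent is split in two: one half absorbs the error of the potential,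
    the other half the constant and the factor [n^-2], kept for summing over sites. *)
Lemma reversible_weight_bound (a : R) : a < 1 -> exists2 C : R, 0 <= C &
  forall n, (0 < n)%N -> reversible_weight p n <=
    C * (n%:R `^ (- (1 + 1)) * expR (- (a * (c * n%:R `^ b)))).
Proof.
move=> a1; apply: near_le_bound.
  by move=> n n0; rewrite mulr_gt0 ?expR_gt0// powR_gt0// ltr0n.
have e0 : 0 < (1 - a) * c / 2 by rewrite divr_gt0// mulr_gt0// subr_gt0.
near=> n.
have n0 : 0 < (n%:R : R) by rewrite ltr0n; near: n; exact: nbhs_infty_gt.
have H1 : `|ln (W n) - c * n%:R `^ b| <= (1 - a) * c / 2 * n%:R `^ b.
  by near: n; exact: ln_odds_prod.
have H2 : - ln kappa + 2 * ln n%:R <= (1 - a) * c / 2 * n%:R `^ b.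
  by near: n; exact: near_ln_le_powR.
(* Crude bound of the weight by [1 / (kappa * W n)], from [q_0 <= 1] and [q_n >= kappa]. *)
apply: (@le_trans _ _ (expR (- ln kappa - ln (W n)))).
  rewrite expRD !expRN !lnK ?posrE//.
  rewrite /reversible_weight ler_pdivrMr ?mulr_gt0 ?(lt_le_trans kappa0 (qkappa n))//.
  rewrite mulrACA mulVf ?gt_eqF// mulr1 mulrC.
  apply: (@le_trans _ _ 1); first by have := p0 0%N; lra.
  by rewrite ler_pdivlMr// mul1r.
rewrite {1}/powR (gt_eqF n0) -expRD ler_expR.
move: H1; rewrite ler_norml => /andP[H1 _]; lra.
Unshelve. all: by end_near. Qed.

(** The potential is a double sum of fewer than [n^2] ratios [W k / W j], up to bounded factors and
    boundary terms: [1 / W] is bounded and [W k] is controlled by the exponential at [n]. *)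
Lemma hitting_potential_bound (a : R) : 1 < a -> exists2 C : R, 0 <= C &
  forall n, (0 < n)%N -> hitting_potential p n <= C * (n%:R ^+ 2 * expR (a * (c * n%:R `^ b))).
Proof.
move=> a1; have [||C1 C10 HC1] := @near_le_bound _ W (fun n => expR (a * (c * n%:R `^ b))).
- by move=> n _; exact: expR_gt0.
- have e0 : 0 < (a - 1) * c by rewrite mulr_gt0// subr_gt0.
  have := ln_odds_prod e0; apply: filterS => n; rewrite ler_norml => /andP[_ H].
  by rewrite -[W n]lnK ?posrE// ler_expR /W; lra.
(* With error [c] the asymptotics give [ln (W n) >= 0] eventually, which bounds the inverse. *)
have [||C2 C20 HC2] := @near_le_bound _ (fun n => (W n)^-1) (fun=> 1).
- by [].
- have := ln_odds_prod c0; apply: filterS => n; rewrite ler_norml => /andP[H _].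
  rewrite invf_le1//; have : 0 <= ln (odds_prod p n) by lra.
  by rewrite -ler_expR expR0 lnK ?posrE.
have E1 (n : nat) : 1 <= expR (a * (c * n%:R `^ b)).
  rewrite -[leLHS]expR0 ler_expR mulr_ge0//; first lra.
  by rewrite mulr_ge0 ?powR_ge0// ltW.
(* The bound by [C1] excludes index 0, where [W 0 = 1]; the constant [1 + C1] covers both cases. *)
have WE k n : (k < n)%N -> W k <= (1 + C1) * expR (a * (c * n%:R `^ b)).
  move=> kn; case: k kn => [|k] kn.
    rewrite /W odds_prod0; apply: (le_trans (E1 n)); rewrite ler_peMl ?expR_ge0//; lra.
  apply: (le_trans (HC1 _ (ltn0Sn k))); apply: ler_pM; rewrite ?expR_ge0//; first lra.
  rewrite ler_expR ler_pM2l ?ler_pM2l//; last lra.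
  by rewrite ge0_ler_powR ?nnegrE ?(ltW b0)// ler_nat ltnW.
have q00 : 0 < 1 - p 0%N by exact: lt_le_trans kappa0 (qkappa 0%N).
exists ((1 + C1) * ((1 - p 0%N)^-1 + C2 / kappa)).
  by rewrite mulr_ge0 ?addr_ge0 ?invr_ge0 ?divr_ge0 ?(ltW q00) ?(ltW kappa0).
move=> n n0; set E := expR _.
have n1 : 1 <= (n%:R : R) by rewrite ler1n.
rewrite /hitting_potential.
apply: (@le_trans _ _ (\sum_(0 <= k < n) ((1 + C1) * E * (((1 - p 0%N)^-1 + C2 / kappa) * n%:R)))).
  apply: ler_sum_nat => k /andP[_ kn]; apply: ler_pM; [exact: ltW|..].
  - apply: addr_ge0; first by rewrite invr_ge0 ltW.
    by apply: sumr_ge0 => j _; rewrite invr_ge0 mulr_ge0 ?(ltW (W0 _))//; exact: le_trans (ltW kappa0) (qkappa j).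
  - exact: WE.
  - rewrite mulrDl lerD//; first by rewrite ler_peMr// invr_ge0 ltW.
    apply: (@le_trans _ _ (\sum_(1 <= j < k.+1) (C2 / kappa))).
      apply: ler_sum_nat => j /andP[j1 _]; rewrite invfM mulrC.
      have qj : 0 < 1 - p j by exact: lt_le_trans kappa0 (qkappa j).
      apply: ler_pM; rewrite ?invr_ge0 ?(ltW (W0 _)) ?(ltW qj)//.
        by have := HC2 _ j1; rewrite mulr1.
      by rewrite lef_pV2 ?posrE.
    rewrite big_const_nat subSS subn0 iter_addr_0 -[leLHS]mulr_natr.
    by rewrite ler_wpM2l ?divr_ge0 ?(ltW kappa0)// ler_nat ltnW.
rewrite big_const_nat subn0 iter_addr_0 -[leLHS]mulr_natr le_eqVlt; apply/orP; left.
by apply/eqP; ring.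
Qed.

End asymptotics.

(** * Quenched bounds *)

Section quenched.
Context d (S : measurableType d) (R : realType) (Q : probability S R).
Context (p : nat -> R) (kappa b c : R) (r : nat) (eta : nat -> {RV Q >-> nat}).
Hypothesis kappa0 : 0 < kappa.
Hypothesis p0 : forall n, 0 < p n.
Hypothesis pkappa : forall n, p n <= 1 - kappa.
Hypothesis b0 : 0 < b.
Hypothesis c0 : 0 < c.
Hypothesis ln_odds_prod : forall e : R, 0 < e ->
  \forall n \near \oo, `|ln (odds_prod p n) - c * n%:R `^ b| <= e * n%:R `^ b.
Hypothesis walk : quenched_walk p r eta.

Let p01 := p_lt1 kappa0 p0 pkappa.

Lemma quenched_upper_bound (theta : R) : 0 < theta ->
  {ae Q, forall v, \forall t \near \oo,
     c * (eta t v)%:R `^ b <= (1 + theta) * ln t%:R}.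
Proof.
(* This [a < 1] satisfies [a * (1 + theta) = 1 + theta / 2]: beyond the threshold the exponential
   factor is at most [t^-(1 + theta/2)], still summable. *)
move=> th0; pose a : R := (1 + theta / 2) / (1 + theta).
have a1 : a < 1 by rewrite /a ltr_pdivrMr; lra.
have aE : a * (1 + theta) = 1 + theta / 2 by rewrite /a divfK// gt_eqF//; lra.
have a0 : 0 < a by rewrite divr_gt0//; lra.
have [C C0 HC] := reversible_weight_bound kappa0 p0 pkappa b0 c0 ln_odds_prod a1.
pose wt := reversible_weight p; have wr0 : 0 < wt r by exact: reversible_weight_gt0.
pose F t := [set v | (1 + theta) * ln t%:R < c * (eta t v)%:R `^ b].
have mF t : measurable (F t).
  exact: (measurable_eta eta t [set k | (1 + theta) * ln t%:R < c * k%:R `^ b]).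
suff : {ae Q, forall v, \forall t \near \oo, ~ F t v}.
  apply: filterS => v; apply: filterS => t /=.
  by move/negP; rewrite -leNgt.
apply: (@borel_cantelli_powR _ _ _ Q F (C / wt r * (1 + 1^-1)) (theta / 2)) => //.
- by apply: mulr_ge0; [rewrite divr_ge0// ltW|lra].
- by rewrite divr_gt0.
exists 1%N => // t /= t1; have t0 : 0 < (t%:R : R) by rewrite ltr0n.
have lnt0 : 0 <= ln (t%:R : R) by rewrite ln_ge0// ler1n.
rewrite (measure_nat_partition (eta t))//.
set T := t%:R `^ _.
(* The factor [i^-2] sums over the sites, and [T] carries the decay in time. *)
apply: (@le_trans _ _ (\sum_(i <oo) (C / wt r * T * i%:R `^ (- (1 + 1)))%:E)%E); last first.
  apply: le_trans (nneseries_powR_le _ _) _ => //.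
    by rewrite mulr_ge0 ?powR_ge0// divr_ge0// ltW.
  by rewrite lee_fin le_eqVlt; apply/orP; left; apply/eqP; ring.
apply: lee_nneseries => [i _ _|i _]; first exact: measure_ge0.
have [Hi|Hi] := ltP ((1 + theta) * ln t%:R) (c * i%:R `^ b); last first.
  rewrite (_ : _ `&` _ = set0) ?measure0 ?lee_fin.
    by rewrite mulr_ge0 ?powR_ge0// mulr_ge0 ?powR_ge0// divr_ge0// ltW.
  apply/seteqP; split => v // -[]; rewrite /F /= => Fv ev.
  by move: Fv; rewrite ev ltNge Hi.
(* The origin never exceeds the threshold, so the weight bound, valid for positive sites,
   applies. *)
have i0 : (0 < i)%N.
  rewrite lt0n; apply/eqP => iE; move: Hi; rewrite iE powR0 ?gt_eqF// mulr0 ltNge.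
  by rewrite mulr_ge0//; lra.
apply: (@le_trans _ _ (Q [set v | eta t v = i])).
  apply: le_measure; rewrite ?inE//.
    by apply: measurableI => //; exact: (measurable_eta eta t [set i]).
  exact: (measurable_eta eta t [set i]).
apply: (le_trans (occupation_bound walk p01 t i (reversible_weight_gt0 p01) (detailed_balance p01))).
rewrite lee_fin -/wt ler_pdivrMr//; apply: (le_trans (HC _ i0)).
have -> : C / wt r * T * i%:R `^ (- (1 + 1)) * wt r = C * (i%:R `^ (- (1 + 1)) * T).
  by field; rewrite gt_eqF.
rewrite ler_wpM2l// ler_wpM2l ?powR_ge0// /T /powR (gt_eqF t0) ler_expR.
rewrite mulNr lerN2 -aE -mulrA ler_pM2l//; exact: ltW.
Qed.

Lemma quenched_lower_bound (theta : R) : 0 < theta ->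
  {ae Q, forall v, infinite_set [set t : nat |
     ln (t%:R : R) <= (1 + theta) * (c * (eta t v)%:R `^ b)]}.
Proof.
move=> th0; pose time n : R := expR ((1 + theta) * (c * n%:R `^ b)).
have time0 n : 0 < time n by exact: expR_gt0.
have a1 : 1 < 1 + theta / 2 by lra.
have [C C0 HC] := hitting_potential_bound kappa0 p0 pkappa b0 c0 ln_odds_prod a1.
pose F n := [set v | forall s, (s < (Num.truncn (time n)).+1)%N -> (eta s v < n)%N].
have mF n : measurable (F n).
  exact: (measurable_cylinder eta (fun=> [set k | (k < n)%N])).
have : {ae Q, forall v, \forall n \near \oo, ~ F n v}.
  apply: (@borel_cantelli_powR _ _ _ Q F C 1) => //.
  near=> n.
  have n0 : (0 < n)%N by near: n; exact: nbhs_infty_gt.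
  have nR0 : 0 < (n%:R : R) by rewrite ltr0n.
  (* Two logarithms cancel the factor [n^2] of the mean hitting time, two more leave the summable
     [n^-2]. *)
  have Hn : 0 + 4 * ln (n%:R : R) <= theta / 2 * c * n%:R `^ b.
    by near: n; apply: near_ln_le_powR => //; rewrite mulr_gt0 ?divr_gt0.
  have := hitting_time_bound walk n (Num.truncn (time n)) (hitting_potential_homo p01)
    (hitting_potential_drift p01).
  move=> /le_trans; apply.
  rewrite lee_fin {2}/hitting_potential big_geq// subr0 ler_pdivrMr//.
  apply: (le_trans (HC _ n0)); rewrite -[leRHS]mulrA; apply: ler_wpM2l => //.
  apply: (@le_trans _ _ (n%:R `^ (- (1 + 1)) * time n)); last first.
    rewrite ler_wpM2l ?powR_ge0// ltW//.
    by have /andP[] := truncn_itv (ltW (time0 n)).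
  have -> : (n%:R : R) `^ (- (1 + 1)) = expR (- (1 + 1) * ln n%:R) by rewrite /powR gt_eqF.
  have -> : (n%:R : R) ^+ 2 = expR (2 * ln n%:R) by rewrite expRM_natl lnK ?posrE.
  by rewrite -!expRD ler_expR; lra.
apply: filterS => v [N _ HN] fin.
have [m mE] : exists m, forall t, ln (t%:R : R) <= (1 + theta) * (c * (eta t v)%:R `^ b) -> (t < m)%N.
  set A := [set t | _] in fin.
  exists (\sum_(t <- fset_set A) t).+1 => t At.
  have tA : t \in fset_set A by rewrite in_fset_set// inE.
  by rewrite ltnS (bigD1_seq t)//= ?fset_uniq//; exact: leq_addr.
(* This level is large enough to be hit in time, yet above every position visited before time [m];
   so it is hit at some time past [m], against the choice of [m]. *)
pose n := (N + (\sum_(0 <= s < m) eta s v).+1)%N.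
have /= nF : ~ F n v by apply: HN; rewrite /= leq_addr.
apply: nF => s sn; rewrite ltnNge; apply/negP => ns.
have sm : (s < m)%N.
  (* Time 0 is separate: [ln 0] is 0 by convention and cannot be exponentiated back. *)
  apply: mE; case: s sn ns => [|s] sn ns.
    by rewrite ln0//; apply: mulr_ge0; [lra|rewrite mulr_ge0 ?powR_ge0// ltW].
  rewrite -ler_expR lnK ?posrE ?ltr0n//.
  apply: (@le_trans _ _ (time n)).
    have /andP[H _] := truncn_itv (ltW (time0 n)).
    by apply: le_trans H; rewrite ler_nat.
  rewrite ler_expR ler_pM2l ?ler_pM2l//; last lra.
  by rewrite ge0_ler_powR ?nnegrE ?(ltW b0)// ler_nat.
move: ns; rewrite /n (bigD1_seq s) ?mem_index_iota ?iota_uniq//=.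
by rewrite leqNgt => /negP; apply; lia.
Unshelve. all: by end_near. Qed.

End quenched.

(** * Sums of independent bounded variables *)

(** Monotone convergence along simple functions increasing to [f], with the nonnegative weight [G]
    carried along. *)
Lemma cvg_integral_approx d d' (T : measurableType d) (T' : measurableType d')
    (R : realType) (P : probability T R) (X : T -> T') (G : T -> R) (f : T' -> R)
    (mf : measurable_fun [set: T'] (EFin \o f)) :
  measurable_fun setT X -> measurable_fun setT G ->
  (forall w, 0 <= G w) -> (forall x, 0 <= f x) ->
  (\int[P]_w (G w * nnsfun_approx measurableT mf n (X w))%:E)%E @[n --> \oo] -->
  (\int[P]_w (G w * f (X w))%:E)%E.
Proof.
move=> mX mG G0 f0; pose h := nnsfun_approx measurableT mf.
have -> : (\int[P]_w (G w * f (X w))%:E =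
    \int[P]_w (limn (fun n => (G w * h n (X w))%:E)))%E.
  apply: eq_integral => w _; apply/esym/cvg_lim => //.
  under eq_fun do rewrite EFinM.
  rewrite EFinM; apply: cvgeZl => //.
  by apply: (@cvg_nnsfun_approx _ _ _ _ measurableT _ mf) => // x _; rewrite lee_fin.
apply: cvg_monotone_convergence => //.
- move=> n; apply/measurable_EFinP; apply: measurable_funM => //.
  by apply: measurableT_comp => //; exact: measurable_funP.
- by move=> n w _; rewrite lee_fin mulr_ge0.
- move=> w _ m n mn; rewrite lee_fin ler_wpM2l//.
  by have /lefP := nd_nnsfun_approx measurableT mf mn; apply.
Qed.

Lemma integral_mul_nnsfun d d' (T : measurableType d) (T' : measurableType d')
    (R : realType) (P : probability T R) (X : T -> T') (G : T -> R)
    (h : {nnsfun T' >-> R}) :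
  measurable_fun setT X -> measurable_fun setT G -> (forall w, 0 <= G w) ->
  (\int[P]_w (G w * h (X w))%:E = \sum_(y <- fset_set (range h))
     `|y|%:E * \int[P]_w (G w * \1_(h @^-1` [set y]) (X w))%:E)%E.
Proof.
move=> mX mG G0.
have mI y : measurable_fun setT (fun w => (G w * \1_(h @^-1` [set y]) (X w))%:E).
  apply/measurable_EFinP; apply: measurable_funM => //.
  by apply: measurableT_comp => //; exact: measurable_indic.
have I0 y w : (0 <= (G w * \1_(h @^-1` [set y]) (X w))%:E)%E.
  by rewrite lee_fin mulr_ge0.
under eq_bigr do rewrite -ge0_integralZl_EFin//.
rewrite -ge0_integral_sum//.
- apply: eq_integral => w _.
  rewrite (fimfunE h (X w)) fsbig_finite//= mulr_sumr -sumEFin.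
  rewrite big_seq [RHS]big_seq; apply: eq_bigr => y.
  rewrite in_fset_set// inE => -[x _ <-].
  by rewrite ger0_norm// -EFinM; congr EFin; ring.
- by move=> y; apply: measurable_funeM.
- by move=> y w _; rewrite mule_ge0.
Qed.

Lemma integral_mul_indep d d' (T : measurableType d) (T' : measurableType d')
    (R : realType) (P : probability T R) (X : T -> T') (G : T -> R) (f : T' -> R) (g : R) :
  measurable_fun setT X -> measurable_fun setT G -> measurable_fun setT f ->
  (forall w, 0 <= G w) -> (forall x, 0 <= f x) ->
  (\int[P]_w (G w)%:E = g%:E)%E ->
  (forall B, measurable B ->
    \int[P]_w (G w * \1_B (X w))%:E = g%:E * P (X @^-1` B))%E ->
  (\int[P]_w (G w * f (X w))%:E = g%:E * \int[P]_w (f (X w))%:E)%E.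
Proof.
move=> mX mG mf G0 f0 Gg indep.
have mEf : measurable_fun setT (EFin \o f) by exact/measurable_EFinP.
pose h := nnsfun_approx measurableT mEf.
have g0 : 0 <= g by rewrite -lee_fin -Gg integral_ge0// => w _; rewrite lee_fin.
have := cvg_integral_approx mEf mX mG G0 f0 (P := P).
have m1 : measurable_fun [set: T] (fun _ : T => 1 : R) by exact: measurable_cst.
have gfin : g%:E \is a fin_num by [].
(* Weight 1 gives the approximation of the right-hand side; both sides are then limits of the same
   sequence. *)
have H1 := cvgeZl gfin (cvg_integral_approx mEf mX m1 (fun=> ler01) f0 (P := P)).
under [X in _ -> _ = (_ * X)%E]eq_integral do rewrite -[f _]mul1r.
set u := (fun n => _) in H1; suff -> : (fun n =>
    \int[P]_w (G w * nnsfun_approx measurableT mEf n (X w))%:E)%E = u.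
  by move=> H2; exact: (cvg_unique _ H2 H1).
apply/funext => n; rewrite /u -/(h n).
rewrite !integral_mul_nnsfun// ge0_sume_distrr; last first.
  move=> y _; apply: mule_ge0; first by rewrite lee_fin.
  by apply: integral_ge0 => w _; rewrite lee_fin mulr_ge0.
apply: eq_bigr => y _; rewrite indep//.
under eq_integral do rewrite mul1r.
have mXy : measurable (X @^-1` (h n @^-1` [set y])).
  by rewrite -[X in measurable X]setTI; apply: mX.
rewrite (_ : \int[P]_w _ = P (X @^-1` (h n @^-1` [set y])))%E; first by rewrite muleCA.
by rewrite -[X in P X]setIT -integral_indic.
Qed.

(** From [exp (-x) >= 1 - x], it suffices that the quadratic times [1 - x], namely
    [1 + x^2 * (1 - 2x)], is at least 1. *)
Lemma expR_le1Dx2 (R : realType) (x : R) : x <= 1 / 2 -> expR x <= 1 + x + 2 * x ^+ 2.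
Proof.
move=> x2; have x1 : 0 < 1 - x by lra.
have h : expR x * (1 - x) <= 1.
  by rewrite -[leRHS](expRxMexpNx_1 x) ler_pM2l ?expR_gt0// expR_ge1Dx.
rewrite -(ler_pM2r x1); apply: (le_trans h).
have : 0 <= x ^+ 2 * (1 - 2 * x) by rewrite mulr_ge0 ?sqr_ge0//; lra.
have -> : (1 + x + 2 * x ^+ 2) * (1 - x) = 1 + x ^+ 2 * (1 - 2 * x) by ring.
lra.
Qed.

Section independent_sums.
Context d d' (T : measurableType d) (T' : measurableType d') (R : realType).
Context (P : probability T R) (X : nat -> T -> T').
Hypothesis mX : forall i, measurable_fun setT (X i).
Hypothesis indep : mutually_independent P X.

Let mXB i (B : set T') : measurable B -> measurable (X i @^-1` B).
Proof. by move=> mB; rewrite -[Y in measurable Y]setTI; apply: mX. Qed.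

Let int_indic i (B : set T') : measurable B ->
  (\int[P]_w (\1_B (X i w))%:E = P (X i @^-1` B))%E.
Proof.
move=> mB; rewrite -[Y in P Y]setIT -integral_indic//; exact: mXB.
Qed.

Lemma expectation_prod_indic n (B : nat -> set T') : (forall i, measurable (B i)) ->
  (\int[P]_w (\prod_(1 <= i < n.+1) \1_(B i) (X i w))%:E =
   \prod_(1 <= i < n.+1) \int[P]_w (\1_(B i) (X i w))%:E)%E.
Proof.
move=> mB; pose I := [fset i in iota 1 n]%fset.
have iI i : (i \in I) = (0 < i < n.+1)%N by rewrite in_fset mem_iota add1n.
have := indep (I := I) (B := B).
have -> : (\prod_(i <- I) P (X i @^-1` B i) =
    \prod_(1 <= i < n.+1) \int[P]_w (\1_(B i) (X i w))%:E)%E.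
  under [RHS]eq_bigr do rewrite int_indic//.
  apply: perm_big; apply: uniq_perm; rewrite ?fset_uniq ?iota_uniq// => i.
  by rewrite iI mem_index_iota.
move=> <-//; last by move=> i; rewrite iI => /andP[].
rewrite -[Y in P Y]setIT -integral_indic//; last first.
  by apply: bigcap_measurableType => i _; exact: mXB.
apply: eq_integral => w _; congr EFin.
have [wB|wB] := pselect ((\bigcap_(i in [set` I]) (X i @^-1` B i)) w).
  rewrite indicE mem_set// big_nat big1// => i iin; rewrite indicE mem_set//.
  by apply: wB; rewrite /= iI.
rewrite indicE memNset//; move/existsNP : wB => [i /not_implyP[/= iin wB]].
rewrite (bigD1_seq i) ?iota_uniq ?mem_index_iota -?iI//=.
by rewrite indicE memNset ?mul0r.
Qed.

Lemma integral_bounded_fin i (f : T' -> R) (K : R) : measurable_fun setT f ->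
  (forall x, 0 <= f x <= K) -> (\int[P]_w (f (X i w))%:E)%E \is a fin_num.
Proof.
move=> mf f0; rewrite ge0_fin_numE.
  apply: (@le_lt_trans _ _ (\int[P]_w (cst K%:E w))%E).
    apply: ge0_le_integral => //.
    - by move=> w _; rewrite lee_fin; have /andP[] := f0 (X i w).
    - by apply/measurable_EFinP; exact: measurableT_comp.
    - by move=> w _; rewrite lee_fin; have /andP[] := f0 (X i w).
  by rewrite integral_cst// [X in (_ * X)%E](probability_setT P) mule1 ltry.
by apply: integral_ge0 => w _; rewrite lee_fin; have /andP[] := f0 (X i w).
Qed.

(* Indicators are replaced by arbitrary functions one factor at a time: [k] counts the
   replaced ones. *)
Lemma expectation_prod n (f : nat -> T' -> R) (K : R) :
  1 <= K -> (forall i, measurable_fun setT (f i)) -> (forall i x, 0 <= f i x <= K) ->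
  (\int[P]_w (\prod_(1 <= i < n.+1) f i (X i w))%:E =
   \prod_(1 <= i < n.+1) \int[P]_w (f i (X i w))%:E)%E.
Proof.
move=> K1; suff H k (g : nat -> T' -> R) (B : nat -> set T') :
    (forall i, measurable (B i)) -> (forall i, (0 < i < n.+1)%N -> (k <= i)%N -> g i = \1_(B i)) ->
    (forall i, measurable_fun setT (g i)) -> (forall i x, 0 <= g i x <= K) ->
    (\int[P]_w (\prod_(1 <= i < n.+1) g i (X i w))%:E =
     \prod_(1 <= i < n.+1) \int[P]_w (g i (X i w))%:E)%E.
  apply: (H n.+1 f (fun=> setT)) => // i.
  by move=> /andP[_ ni] /(leq_trans ni); rewrite ltnn.
elim: k g B => [|k IH] g B mB gB mg g0.
  transitivity (\int[P]_w (\prod_(1 <= i < n.+1) \1_(B i) (X i w))%:E)%E.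
    apply: eq_integral => w _; congr EFin; apply: eq_big_nat => i ni.
    by rewrite gB.
  rewrite expectation_prod_indic//; apply: eq_big_nat => i ni.
  by rewrite gB.
have [kn|kn] := boolP (k \in index_iota 1 n.+1); last first.
  apply: (IH g B) => // i ni ki; apply: gB => //; rewrite ltn_neqAle ki andbT.
  by apply: contraNneq kn => ->; rewrite mem_index_iota.
(* With an indicator at place [k], the induction hypothesis separates the event [X k \in C] from the
   other factors, as [integral_mul_indep] requires. *)
pose upd (C : set T') i := if i == k then \1_C else g i.
pose e i : R := fine (\int[P]_w (g i (X i w))%:E)%E.
have eE i : (\int[P]_w (g i (X i w))%:E = (e i)%:E)%E.
  by rewrite fineK//; exact: integral_bounded_fin.
pose G w : R := \prod_(1 <= i < n.+1 | i != k) g i (X i w).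
have E (C : set T') : measurable C -> (\int[P]_w (G w * \1_C (X k w))%:E =
    (\prod_(1 <= i < n.+1 | i != k) e i)%:E * P (X k @^-1` C))%E.
  move=> mC; have := IH (upd C) (fun i => if i == k then C else B i).
  have -> : (\int[P]_w (\prod_(1 <= i < n.+1) upd C i (X i w))%:E =
      \int[P]_w (G w * \1_C (X k w))%:E)%E.
    apply: eq_integral => w _; congr EFin.
    rewrite (bigD1_seq k) ?iota_uniq//= /upd eqxx mulrC; congr (_ * _).
    by apply: eq_bigr => i /negPf ->.
  have -> : (\prod_(1 <= i < n.+1) \int[P]_w (upd C i (X i w))%:E =
      (\prod_(1 <= i < n.+1 | i != k) e i)%:E * P (X k @^-1` C))%E.
    rewrite (bigD1_seq k) ?iota_uniq//= /upd eqxx int_indic// muleC -prodEFin.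
    by congr (_ * _)%E; apply: eq_bigr => i /negPf ->.
  apply.
  - by move=> i; case: eqP.
  - move=> i ni ki; rewrite /upd; case: eqP => // /eqP ik; apply: gB => //.
    by rewrite ltn_neqAle ki andbT eq_sym.
  - by move=> i; rewrite /upd; case: eqP => // _; exact: measurable_indic.
  - move=> i x; rewrite /upd; case: eqP => // _; rewrite indicE.
    by case: (_ \in _); rewrite ?lexx ?ler01 ?K1 ?(le_trans ler01 K1).
rewrite (bigD1_seq k) ?iota_uniq//= [in RHS]muleC.
under [in RHS]eq_bigr do rewrite eE.
rewrite prodEFin -(@integral_mul_indep _ _ _ _ _ P (X k) G (g k)) //.
- apply: eq_integral => w _; congr EFin.
  by rewrite (bigD1_seq k) ?iota_uniq//= mulrC.
- by rewrite /G; under eq_fun do rewrite -big_filter; apply: measurable_prod => i _; exact: measurableT_comp.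
- by move=> w; apply: prodr_ge0 => i _; have /andP[] := g0 i (X i w).
- by move=> x; have /andP[] := g0 k x.
- have := E setT measurableT; rewrite preimage_setT probability_setT mule1 => <-.
  by apply: eq_integral => w _; rewrite indicT mulr1.
Qed.

(** * Exponential moments and Chernoff's bound *)

Section chernoff.
Context (f : nat -> T' -> R) (M : R).
Hypothesis mf : forall i, measurable_fun setT (f i).
Hypothesis fM : forall i x, `|f i x| <= M.
Hypothesis Ef : forall i, (1 <= i)%N -> (\int[P]_w (f i (X i w))%:E = 0)%E.

Let mfX i : measurable_fun setT (fun w => f i (X i w)).
Proof. exact: measurableT_comp. Qed.

Lemma measurable_sum_ge n (a : R) :
  measurable [set w | a <= \sum_(1 <= i < n.+1) f i (X i w)].
Proof.
rewrite -[Y in measurable Y]setTI; apply: measurable_fun_le => //.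
by apply: measurable_sum => i; exact: mfX.
Qed.

(** The linear term of the quadratic bound on the exponential integrates to 0 by centring, and
    [1 + v <= exp v] closes. *)
Lemma mgf_bound (s : R) i : (1 <= i)%N -> 0 <= s -> s * M <= 1 / 2 ->
  (\int[P]_w (expR (s * f i (X i w)))%:E <= (expR (2 * (s * M) ^+ 2))%:E)%E.
Proof.
move=> i1 s0 sM.
have msf : measurable_fun setT (fun w => s * f i (X i w)) by exact: measurable_funM.
have sfM w : `|s * f i (X i w)| <= s * M by rewrite normrM ger0_norm// ler_wpM2l.
have intf : P.-integrable setT (EFin \o (fun w => f i (X i w))).
  apply: measurable_bounded_integrable => //.
    exact: le_lt_trans (probability_le1 P measurableT) (ltry 1).
  by exists M; split; [exact: num_real|move=> y My w _; exact: le_trans (fM i _) (ltW My)].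
apply: (@le_trans _ _ (\int[P]_w ((1 + 2 * (s * M) ^+ 2)%:E + s%:E * (f i (X i w))%:E))%E).
  apply: ge0_le_integral => //.
  - by apply/measurable_EFinP; exact: measurableT_comp.
  - by apply: emeasurable_funD => //; apply: measurable_funeM; exact/measurable_EFinP.
  move=> w _; rewrite -EFinM -EFinD lee_fin.
  have := sfM w; rewrite ler_norml => /andP[h1 h2].
  apply: (le_trans (expR_le1Dx2 _)); first lra.
  have : (s * f i (X i w)) ^+ 2 <= (s * M) ^+ 2.
    by rewrite -real_normK ?num_real// ler_pXn2r ?nnegrE// (le_trans _ (sfM w)).
  lra.
rewrite integralD//; last 2 first.
- by apply: finite_measure_integrable_cst.
- exact: integrableZl.
rewrite integral_cst// [X in (_ * X)%E](probability_setT P) mule1 integralZl// Ef// mule0 adde0 lee_fin.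
exact: expR_ge1Dx.
Qed.

Lemma chernoff_sum n (a s : R) : 0 <= s -> s * M <= 1 / 2 ->
  (P [set w | (a <= \sum_(1 <= i < n.+1) f i (X i w))%R] <=
   (expR (n%:R * (2 * (s * M) ^+ 2) - s * a))%:E)%E.
Proof.
move=> s0 sM; set A := [set w | _].
have mA : measurable A by exact: measurable_sum_ge.
rewrite -[A]setIT -integral_indic//.
pose F i x := expR (s * f i x).
have mF i : measurable_fun setT (F i).
  by apply: measurableT_comp => //; exact: measurable_funM.
have mFX i : measurable_fun setT (fun w => F i (X i w)) by exact: measurableT_comp.
have mprod : measurable_fun setT (fun w => \prod_(1 <= i < n.+1) F i (X i w)).
  by apply: measurable_prod => i _.
(* Exponential Markov inequality: the indicator of [A] is at most [exp (s * (sum - a))], which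
   independence factorises. *)
apply: (@le_trans _ _ (\int[P]_w ((expR (- (s * a)))%:E * (\prod_(1 <= i < n.+1) F i (X i w))%:E))%E).
  apply: ge0_le_integral => //.
  - by apply/measurable_EFinP; exact: measurable_indic.
  - by apply: measurable_funeM; exact/measurable_EFinP.
  move=> w _; rewrite -EFinM lee_fin indicE.
  rewrite -expR_sum -expRD; have [|_] := boolP (w \in A); last exact: expR_ge0.
  rewrite inE => wA; rewrite -[leLHS]expR0 ler_expR -mulr_sumr addrC -mulrBr.
  by rewrite mulr_ge0// subr_ge0.
rewrite ge0_integralZl_EFin ?expR_ge0//; last 2 first.
- by move=> w _; rewrite lee_fin prodr_ge0// => i _; exact: expR_ge0.
- exact/measurable_EFinP.
rewrite (@expectation_prod n F (expR (1 / 2))) //; last 2 first.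
- by rewrite -[leLHS]expR0 ler_expR; lra.
- move=> i x; rewrite expR_ge0 ler_expR (le_trans _ sM)//.
  by rewrite ler_wpM2l// (le_trans (ler_norm _)).
apply: (@le_trans _ _ ((expR (- (s * a)))%:E * \prod_(1 <= i < n.+1) (expR (2 * (s * M) ^+ 2))%:E)%E).
  rewrite lee_wpmul2l ?lee_fin ?expR_ge0// big_nat_cond [leRHS]big_nat_cond.
  set I1 := (X in (X <= _)%E); set I2 := (X in (_ <= X)%E).
  suff /andP[] : ((0 <= I1) && (I1 <= I2))%E by [].
  (* Nonnegativity is carried through the induction, since multiplying inequalities requires it. *)
  rewrite /I1 /I2; elim/big_ind2 : _ => [|x1 y1 x2 y2 /andP[? ?] /andP[? ?]|i].
  - by rewrite lexx lee_fin ler01.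
  - by rewrite mule_ge0//= lee_pmul.
  - move=> /andP[/andP[i1 _] _]; rewrite mgf_bound// andbT.
    by apply: integral_ge0 => w _; rewrite lee_fin expR_ge0.
rewrite prodEFin -EFinM lee_fin big_const_nat subSS subn0 iter_mulr_1 -expRM_natl -expRD.
by rewrite ler_expR; lra.
Qed.

End chernoff.

(** The tolerances [1 / (k+1)] suffice, so only countably many null sets occur. The bound is
    one-sided; the other side comes from [- f]. *)
Lemma ae_sum_le_powR (f : nat -> T' -> R) (M b : R) : 1 / 2 < b ->
  (forall i, measurable_fun setT (f i)) -> (forall i x, `|f i x| <= M) ->
  (forall i, (1 <= i)%N -> (\int[P]_w (f i (X i w))%:E = 0)%E) ->
  {ae P, forall w, forall e : R, 0 < e -> \forall n \near \oo,
     \sum_(1 <= i < n.+1) f i (X i w) <= e * n%:R `^ b}.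
Proof.
move=> b12 mf fM Ef.
(* A strictly positive bound, fit to be a denominator. *)
pose N : R := `|M| + 1.
have N0 : 0 < N by rewrite ltr_pwDr.
have fN i x : `|f i x| <= N.
  by rewrite (le_trans (fM i x))// (le_trans (ler_norm M))// lerDl.
suff H k : {ae P, forall w, \forall n \near \oo,
    ~ (k.+1%:R^-1 * n%:R `^ b <= \sum_(1 <= i < n.+1) f i (X i w))}.
  have := ae_forall_nat H; apply: filterS => w Hw e e0.
  pose k := Num.truncn e^-1.
  have ke : k.+1%:R^-1 <= e.
    rewrite invf_ple ?posrE// ltW//.
    by have /andP[] := truncn_itv (ltW (eq_ind_r (fun x => is_true x) e0 (invr_gt0 e))).
  apply: filterS (Hw k) => n /negP; rewrite -ltNge => /ltW /le_trans; apply.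
  by rewrite ler_wpM2r ?powR_ge0.
pose eps : R := k.+1%:R^-1; have eps0 : 0 < eps by rewrite invr_gt0.
apply: (@borel_cantelli_powR _ _ _ P
  (fun n => [set w | eps * n%:R `^ b <= \sum_(1 <= i < n.+1) f i (X i w)]) 1 1) => //.
  by move=> n; exact: measurable_sum_ge.
have b0 : 0 < b - 1 / 2 by lra.
have eN0 : 0 < eps / (2 * N) by rewrite divr_gt0// mulr_gt0.
near=> n.
have n0 : 0 < (n%:R : R) by rewrite ltr0n; near: n; exact: nbhs_infty_gt.
have n1 : 1 <= (n%:R : R) by near: n; exact: nbhs_infty_ger.
(* The [1 / 2] is the variance term of Chernoff's bound, and the two logarithms produce [n^-2]. *)
have Hn : 1 / 2 + 2 * ln (n%:R : R) <= eps / (2 * N) * n%:R `^ (b - 1 / 2).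
  by near: n; exact: near_ln_le_powR.
(* This choice of the Chernoff parameter makes the variance term constant in [n]. *)
pose s : R := (n%:R `^ (- (1 / 2))) / (2 * N).
have s0 : 0 <= s by rewrite divr_ge0 ?powR_ge0// mulr_ge0// ltW.
have sN : s * N = n%:R `^ (- (1 / 2)) / 2 by rewrite /s; field; rewrite gt_eqF.
apply: (le_trans (chernoff_sum mf fN Ef n _ s0 _)).
  rewrite sN ler_pM2r// -[leRHS](powRr0 n%:R) ler_powR//; lra.
rewrite lee_fin mul1r {2}/powR (gt_eqF n0) ler_expR sN.
have -> : n%:R * (2 * (n%:R `^ (- (1 / 2)) / 2) ^+ 2) = 1 / 2 :> R.
  have -> : (n%:R `^ (- (1 / 2)) / 2) ^+ 2 = n%:R^-1 / 4 :> R.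
    rewrite expr_div_n -[_ ^+ 2]powR_mulrn ?powR_ge0// -powRrM.
    rewrite (_ : - (1 / 2) * 2%:R = -1); last lra.
    by rewrite powR_inv1// expr2; lra.
  by field; rewrite gt_eqF.
have -> : s * (eps * n%:R `^ b) = eps / (2 * N) * n%:R `^ (b - 1 / 2).
  rewrite /s powRD; last by rewrite (gt_eqF n0) implybT.
  by ring.
lra.
Unshelve. all: by end_near. Qed.

End independent_sums.

(** * Asymptotics of the potential *)

(** Both sides come from [ln (1 + v) <= v]: at [u] for the upper bound, and at [- u / (1 + u)],
    through the inverse of [1 + u], for the lower one. *)
Lemma norm_ln1Dx_le (R : realType) (u : R) : `|u| <= 1 / 2 -> `|ln (1 + u) - u| <= 2 * u ^+ 2.
Proof.
rewrite ler_norml => /andP[u1 u2]; have u0 : 0 < 1 + u by lra.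
have h1 : ln (1 + u) <= u by apply: le_ln1Dx; lra.
have h2 : u / (1 + u) <= ln (1 + u).
  have E : (1 + u)^-1 = 1 + - (u / (1 + u)) by field; rewrite gt_eqF.
  have : ln (1 + - (u / (1 + u))) <= - (u / (1 + u)).
    apply: le_ln1Dx; rewrite ltrN2 ltr_pdivrMr//; lra.
  by rewrite -E lnV ?posrE//; lra.
have h3 : u - 2 * u ^+ 2 <= u / (1 + u).
  rewrite ler_pdivlMr//.
  have : 0 <= u ^+ 2 * (1 + 2 * u) by rewrite mulr_ge0 ?sqr_ge0//; lra.
  have -> : (u - 2 * u ^+ 2) * (1 + u) = u - u ^+ 2 * (1 + 2 * u) by ring.
  lra.
have := sqr_ge0 u; rewrite ler_norml => u20; apply/andP; split; lra.
Qed.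

Lemma norm_ln_odds_le (R : realType) (kappa x : R) : 0 < kappa ->
  kappa <= x <= 1 - kappa -> `|ln (x / (1 - x))| <= kappa^-1.
Proof.
move=> k0 /andP[x1 x2]; have x0 : 0 < x by lra. have y0 : 0 < 1 - x by lra.
have k1 : 1 - x <= 1 by lra. have k2 : x <= 1 by lra.
have H (a b : R) : 0 < a -> a <= 1 -> kappa <= b -> ln (a / b) <= kappa^-1.
  move=> a0 a1 kb; have b0 : 0 < b by lra.
  apply: (le_trans (ltW (ln_sublinear (divr_gt0 a0 b0)))).
  rewrite ler_pdivrMr//; apply: (le_trans a1).
  by rewrite mulrC ler_pdivlMr// mul1r.
rewrite ler_norml lerNl H ?andbT//; last lra.
rewrite -lnV ?posrE ?divr_gt0// invf_div H//.
Qed.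

(** With [u = h / x] and [v = h / (1 - x)], the difference of log-odds is [ln (1 + u) - ln (1 - v)]
    and the linear term is [u + v]; each logarithm errs by at most [2 h^2 / delta^2]. *)
Lemma ln_odds_taylor (R : realType) (delta x h : R) : 0 < delta ->
  delta <= x <= 1 - delta -> `|h| <= delta / 2 ->
  `|ln ((x + h) / (1 - (x + h))) - ln (x / (1 - x)) - h / (x * (1 - x))| <=
  4 / delta ^+ 2 * h ^+ 2.
Proof.
move=> d0 /andP[x1 x2] hd; have x0 : 0 < x by lra. have y0 : 0 < 1 - x by lra.
have small a : delta <= a -> `|h / a| <= 1 / 2 /\ (h / a) ^+ 2 <= h ^+ 2 / delta ^+ 2.
  move=> da; have a0 : 0 < a by lra.
  split; first by rewrite normrM normfV (gtr0_norm a0) ler_pdivrMr//; lra.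
  rewrite expr_div_n ler_wpM2l ?sqr_ge0// lef_pV2 ?posrE ?exprn_gt0//.
  by rewrite ler_pXn2r// nnegrE ltW.
have [u1 u2] := small x x1; have [|v1 v2] := small (1 - x); first lra.
set u := h / x in u1 u2 *; set v := h / (1 - x) in v1 v2 *.
have nv1 : `|- v| <= 1 / 2 by rewrite normrN.
have := norm_ln1Dx_le u1; have := norm_ln1Dx_le nv1; rewrite sqrrN.
have u0 : 0 < 1 + u by move: u1; rewrite ler_norml => /andP[? ?]; lra.
have v0 : 0 < 1 - v by move: v1; rewrite ler_norml => /andP[? ?]; lra.
have -> : x + h = x * (1 + u) by rewrite /u; field; rewrite gt_eqF.
have -> : 1 - x * (1 + u) = (1 - x) * (1 - v) by rewrite /u /v; field; rewrite !gt_eqF.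
have -> : h / (x * (1 - x)) = u + v by rewrite /u /v; field; rewrite !gt_eqF.
rewrite !ln_div ?posrE ?mulr_gt0// !lnM ?posrE//.
have -> : 4 / delta ^+ 2 * h ^+ 2 = 4 * (h ^+ 2 / delta ^+ 2) by ring.
rewrite !ler_norml => /andP[? ?] /andP[? ?]; apply/andP; clearbody u v; split; lra.
Qed.

(** Discretisation error of the derivative of [k^(1-a)], stated with the weaker order [k^(-2a)] to
    match the Taylor error of the environment. *)
Lemma powR_increment (R : realType) (a : R) (k : nat) : 0 < a < 1 -> (0 < k)%N ->
  `|k%:R `^ (1 - a) - k.-1%:R `^ (1 - a) - (1 - a) * k%:R `^ (- a)| <=
  2 * k%:R `^ (- a) ^+ 2.
Proof.
move=> /andP[a0 a1] k0; case: k k0 => // -[|k] _ /=.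
  (* At [k = 1] the relative step is 1, too large for the expansion; the difference is just [a]. *)
  by rewrite !powR1 powR0 ?gt_eqF// ?subr_gt0// expr1n ger0_norm; lra.
set x : R := k.+2%:R; have x2 : 2 <= x by rewrite ler_nat.
have x0 : 0 < x by lra.
have -> : k.+1%:R = x * (1 - x^-1).
  by rewrite mulrBr mulr1 divff ?gt_eqF// /x -(natrB _ (isT : 1 <= k.+2)%N) subn1.
have u0 : 0 < x^-1 by rewrite invr_gt0.
have u1 : x^-1 <= 1 / 2 by rewrite div1r lef_pV2 ?posrE.
clearbody x.
set u := x^-1 in u0 u1 *.
rewrite powRM ?(ltW x0)//; last lra.
have -> : x `^ (- a) = x `^ (1 - a) * u.
  have := @powRD _ x (1 - a) (-1).
  rewrite (gt_eqF x0) implybT powR_inv1 ?(ltW x0)// => /(_ isT) <-.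
  by congr (_ `^ _); lra.
set y := x `^ (1 - a); have y0 : 0 < y by rewrite powR_gt0.
set z := (1 - u) `^ (1 - a).
have ln1 : `|ln (1 + - u) - - u| <= 2 * (- u) ^+ 2.
  by apply: norm_ln1Dx_le; rewrite normrN gtr0_norm.
have H : `|1 - z - (1 - a) * u| <= 2 * u ^+ 2.
  have zE : z = expR ((1 - a) * ln (1 + - u)) by rewrite /z /powR gt_eqF//; lra.
  have z1 : 1 + (1 - a) * ln (1 + - u) <= z by rewrite zE expR_ge1Dx.
  have z2 : z <= 1 + - ((1 - a) * u) + 2 * (- ((1 - a) * u)) ^+ 2.
    apply: le_trans (expR_le1Dx2 _); last first.
      have : 0 <= (1 - a) * u by rewrite mulr_ge0// ltW// subr_gt0.
      lra.
    rewrite zE ler_expR -mulrN ler_wpM2l//; first by rewrite ltW// subr_gt0.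
    by apply: le_ln1Dx; lra.
  have aa : (1 - a) ^+ 2 <= 1 by rewrite expr_le1//; lra.
  have := ler_wpM2r (sqr_ge0 u) aa; rewrite mul1r.
  move: z2; rewrite sqrrN exprMn => z2 aau.
  move: ln1; rewrite sqrrN ler_norml => /andP[l1 l2].
  have l3 : (1 - a) * (- u - 2 * u ^+ 2) <= (1 - a) * ln (1 + - u).
    by rewrite ler_wpM2l//; lra.
  have l4 : 0 <= a * u ^+ 2 by rewrite mulr_ge0 ?sqr_ge0// ltW.
  rewrite ler_norml; apply/andP; split; lra.
have -> : y - y * z - (1 - a) * (y * u) = y * (1 - z - (1 - a) * u) by ring.
rewrite normrM (gtr0_norm y0).
have y1 : 1 <= y by rewrite -(powRr0 x) ler_powR ?subr_ge0 ?(ltW a1)//; lra.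
rewrite exprMn; apply: (@le_trans _ _ (y * (2 * u ^+ 2))).
  by rewrite ler_pM2l.
have : y * u ^+ 2 <= y ^+ 2 * u ^+ 2.
  by rewrite ler_wpM2r ?sqr_ge0// expr2 ler_peMr// ltW.
lra.
Qed.

Lemma sum_powR_le (R : realType) (g : R) (n : nat) : 0 < g <= 1 ->
  \sum_(1 <= k < n.+1) k%:R `^ (g - 1) <= 2 / g * n%:R `^ g.
Proof.
move=> /andP[g0 g1]; elim: n => [|n IH].
  by rewrite big_geq// mulr_ge0 ?powR_ge0// divr_ge0// ltW.
rewrite big_nat_recr//=; case: n IH => [|n] IH.
  by rewrite big_geq// !powR1 add0r mulr1 ler_pdivlMr//; lra.
apply: (le_trans (lerD IH (lexx _))).
set x : R := n.+2%:R; have x2 : 2 <= x by rewrite ler_nat.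
have x0 : 0 < x by lra.
have -> : n.+1%:R = x * (1 - x^-1).
  by rewrite mulrBr mulr1 divff ?gt_eqF// /x -(natrB _ (isT : 1 <= n.+2)%N) subn1.
have u0 : 0 < x^-1 by rewrite invr_gt0.
have u1 : x^-1 <= 1 / 2 by rewrite div1r lef_pV2 ?posrE.
clearbody x.
set u := x^-1 in u0 u1 *.
rewrite powRM ?(ltW x0)//; last lra.
have -> : x `^ (g - 1) = x `^ g * u.
  by rewrite powRB ?powRr1 ?(ltW x0)// (gt_eqF x0) implybT.
set y := x `^ g; have y0 : 0 < y by rewrite powR_gt0.
set z := (1 - u) `^ g.
have gu : 0 < g * u by rewrite mulr_gt0.
(* Through [exp (- t) <= 1 / (1 + t) <= 1 - t / 2] for [0 <= t <= 1]; the halved slope is why the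
   constant is [2 / g]. *)
have z1 : z <= 1 - g * u / 2.
  have -> : z = expR (g * ln (1 + - u)) by rewrite /z /powR gt_eqF//; lra.
  apply: (@le_trans _ _ (expR (- (g * u)))).
    by rewrite ler_expR -mulrN ler_wpM2l ?(ltW g0)//; apply: le_ln1Dx; lra.
  rewrite expRN -[leRHS]invrK lef_pV2 ?posrE ?expR_gt0 ?invr_gt0//; last first.
    have : g * u <= 1 * u by rewrite ler_wpM2r// ltW.
    lra.
  have gu1 : g * u <= 1 * u by rewrite ler_wpM2r// ltW.
  apply: le_trans (expR_ge1Dx _); rewrite -[leLHS]div1r ler_pdivrMr; last lra.
  have : 0 <= g * u * (1 - g * u) by rewrite mulr_ge0 ?(ltW gu)//; lra.
  clearbody u; move: (g * u) gu gu1 => t; lra.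
have := ler_wpM2l (ltW y0) z1.
have g2 : 0 < 2 / g by rewrite divr_gt0.
move=> /(ler_wpM2l (ltW g2)) H.
have E : 2 / g * (y * (1 - g * u / 2)) = 2 / g * y - y * u by field; rewrite gt_eqF.
move: H; rewrite E; lra.
Qed.

(** * Potential of a fixed environment *)

Section environment.
Context (R : realType) (delta alpha lambda : R) (x y : nat -> R).
Hypothesis delta01 : 0 < delta < 1 / 2.
Hypothesis alpha01 : 0 < alpha < 1 / 2.
Hypothesis x_itv : forall k, (0 < k)%N -> delta <= x k <= 1 - delta.
Hypothesis y_itv : forall k, (0 < k)%N -> `|y k| <= 1.

Let p := env delta alpha x y.

Lemma env_itv n : delta / 2 <= p n <= 1 - delta / 2.
Proof.
have /andP[d0 d1] := delta01.
case: n => [|n] /=; first by apply/andP; split; lra.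
rewrite /truncate; case: ltP => h1; first by apply/andP; split; lra.
by case: ltP => h2; apply/andP; split; lra.
Qed.

Let p01 n : 0 < p n < 1.
Proof.
have /andP[d0 _] := delta01; have /andP[h1 h2] := env_itv n.
by apply/andP; split; lra.
Qed.

Lemma ln_odds_env_bound : exists2 C : R, 0 <= C & forall k, (0 < k)%N ->
  `|ln (p k / (1 - p k)) - ln (x k / (1 - x k)) -
    y k / (x k * (1 - x k)) * k%:R `^ (- alpha)| <= C * k%:R `^ (- alpha) ^+ 2.
Proof.
have /andP[d0 d1] := delta01; have /andP[a0 a1] := alpha01.
have di0 : 0 < delta^-1 by rewrite invr_gt0.
have d20 : 0 < delta ^+ 2 by rewrite exprn_gt0.
have d2i0 : 0 < (delta ^+ 2)^-1 by rewrite invr_gt0.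
(* The three summands of [B] bound the log-odds of [p k], those of [x k], and the linear term. *)
pose B := (delta / 2)^-1 + delta^-1 + (delta ^+ 2)^-1.
have B0 : 0 < B by rewrite !addr_gt0// invr_gt0 divr_gt0.
exists (4 / delta ^+ 2 * (1 + B)).
  by apply: mulr_ge0; [rewrite divr_ge0// ltW|rewrite addr_ge0// ltW].
move=> k k0; have xk := x_itv k0; have yk := y_itv k0.
set nu := k%:R `^ (- alpha).
have nu0 : 0 < nu by rewrite powR_gt0// ltr0n.
have nu1 : nu <= 1.
  by rewrite /nu -[leRHS](powRr0 (k%:R : R)) ler_powR ?ler1n//; lra.
have [small|big] := leP nu (delta / 2).
  have hy : `|y k * nu| <= delta / 2.
    by rewrite normrM (gtr0_norm nu0) (le_trans _ small)// ler_piMl// ltW.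
  have pE : p k = x k + y k * nu.
    case: k k0 xk yk @nu nu0 nu1 small hy => // k _ /andP[xk1 xk2] yk nu nu0 nu1 small.
    rewrite ler_norml => /andP[h1 h2].
    rewrite /p /= /truncate -/nu; case: ltP => h3; first lra.
    by case: ltP => h4 //; lra.
  rewrite pE [y k / _ * nu]mulrAC; apply: (le_trans (ln_odds_taylor d0 xk hy)).
  have : (y k * nu) ^+ 2 <= nu ^+ 2.
    rewrite exprMn ler_piMl ?sqr_ge0// -real_normK ?num_real// expr_le1//.
  move=> h; apply: (@le_trans _ _ (4 / delta ^+ 2 * nu ^+ 2)).
    by rewrite ler_wpM2l// divr_ge0// ltW.
  rewrite ler_wpM2r ?sqr_ge0// ler_peMr ?divr_ge0 ?(ltW d20)//; lra.
(* Here the truncation may be active, but then [nu] is bounded below and crude bounds suffice. *)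
have d20' : 0 < delta / 2 by lra.
have h1 := norm_ln_odds_le d20' (env_itv k).
have h2 := norm_ln_odds_le d0 xk.
have /andP[xk1 xk2] := xk.
have h3 : `|y k / (x k * (1 - x k)) * nu| <= (delta ^+ 2)^-1.
  rewrite normrM (gtr0_norm nu0) normrM normfV.
  have dx : delta ^+ 2 <= x k * (1 - x k) by rewrite expr2 ler_pM//; lra.
  have dx0 : 0 < x k * (1 - x k) by exact: lt_le_trans dx.
  rewrite (gtr0_norm dx0) -[leRHS]mulr1 ler_pM ?mulr_ge0 ?invr_ge0 ?(ltW dx0) ?(ltW nu0)//.
  by rewrite -[leRHS]mul1r ler_pM ?invr_ge0 ?(ltW dx0)// lef_pV2 ?posrE.
have h4 : `|ln (p k / (1 - p k)) - ln (x k / (1 - x k)) - y k / (x k * (1 - x k)) * nu| <= B.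
  apply: (le_trans (ler_normB _ _)); rewrite /B lerD//.
  by apply: (le_trans (ler_normB _ _)); rewrite lerD.
apply: (le_trans h4).
have h5 : 1 <= 4 / delta ^+ 2 * nu ^+ 2.
  have : (delta / 2) ^+ 2 <= nu ^+ 2 by rewrite ler_pXn2r ?nnegrE ?(ltW d20') ?(ltW nu0) ?(ltW big).
  move=> h; apply: (@le_trans _ _ (4 / delta ^+ 2 * (delta / 2) ^+ 2)).
    by rewrite le_eqVlt; apply/orP; left; apply/eqP; field; rewrite gt_eqF.
  by rewrite ler_wpM2l// divr_ge0// ltW.
have := ler_wpM2r (ltW (addr_gt0 ltr01 B0)) h5; rewrite mul1r mulrAC; lra.
Qed.

Lemma ln_odds_prodE n :
  ln (odds_prod p n) = \sum_(1 <= k < n.+1) ln (p k / (1 - p k)).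
Proof.
elim: n => [|n IH]; first by rewrite odds_prod0 ln1 big_geq.
rewrite odds_prodS [in RHS]big_nat_recr//= -IH lnM ?posrE ?odds_prod_gt0//.
by have /andP[? ?] := p01 n.+1; rewrite divr_gt0// subr_gt0.
Qed.

Lemma ln_odds_prod_env :
  (forall e : R, 0 < e -> \forall n \near \oo,
    `|\sum_(1 <= k < n.+1) (ln (x k / (1 - x k)) +
       (y k / (x k * (1 - x k)) - lambda) * k%:R `^ (- alpha))| <= e * n%:R `^ (1 - alpha)) ->
  forall e : R, 0 < e -> \forall n \near \oo,
    `|ln (odds_prod p n) - lambda / (1 - alpha) * n%:R `^ (1 - alpha)|
      <= e * n%:R `^ (1 - alpha).
Proof.
have /andP[a0 a1] := alpha01; set b := 1 - alpha; have b0 : 0 < b by rewrite /b; lra.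
move=> Hsum e e0; have [C C0 HC] := ln_odds_env_bound.
pose c := lambda / b; pose K := C + `|c| * 2.
have K0 : 0 <= K by rewrite addr_ge0// mulr_ge0.
pose N k : R := k%:R `^ (- alpha).
(* [r] is the Taylor remainder of the log-odds, and [t] the error in writing [c * n^b] as a sum of
   [lambda * k^-alpha]. *)
pose r k : R := ln (p k / (1 - p k)) - ln (x k / (1 - x k)) - y k / (x k * (1 - x k)) * N k.
pose t k : R := - c * (k%:R `^ b - k.-1%:R `^ b - b * N k).
have rt k : (0 < k)%N -> `|r k + t k| <= K * (N k ^+ 2).
  move=> k0; apply: (le_trans (ler_normD _ _)); rewrite mulrDl lerD ?HC//.
  rewrite /t normrM normrN -mulrA ler_wpM2l//; apply: powR_increment => //.
  by apply/andP; split; lra.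
have cb : c * b = lambda by rewrite divfK// gt_eqF.
have decomp n : ln (odds_prod p n) - c * n%:R `^ b =
    \sum_(1 <= k < n.+1) (ln (x k / (1 - x k)) + (y k / (x k * (1 - x k)) - lambda) * N k)
    + \sum_(1 <= k < n.+1) (r k + t k).
  have -> : c * n%:R `^ b = \sum_(1 <= k < n.+1) c * (k%:R `^ b - k.-1%:R `^ b).
    elim: n => [|n IH]; first by rewrite big_geq// powR0 ?mulr0 ?gt_eqF.
    by rewrite big_nat_recr//= -IH; ring.
  rewrite ln_odds_prodE -sumrB -big_split/=; apply: eq_bigr => k _.
  by rewrite /r /t -cb; ring.
(* The remainders sum to [O(n^g)], smaller than [n^b] by the factor [n^alpha]. *)
pose g := 1 - alpha *+ 2; have g0 : 0 < g <= 1 by rewrite /g; apply/andP; split; lra.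
have g00 : 0 < g by case/andP : g0.
have e20 : 0 < e / 2 by lra.
near=> n.
have n0 : 0 < (n%:R : R) by rewrite ltr0n; near: n; exact: nbhs_infty_gt.
have H1 : `|\sum_(1 <= k < n.+1) (ln (x k / (1 - x k)) +
    (y k / (x k * (1 - x k)) - lambda) * N k)| <= e / 2 * n%:R `^ b.
  by near: n; exact: Hsum.
have H2 : (e / 2)^-1 * (K * (2 / g)) <= n%:R `^ alpha.
  by near: n; exact: near_powR_ge.
rewrite decomp; apply: (le_trans (ler_normD _ _)).
rewrite [X in _ <= X * _](splitr e) mulrDl lerD//.
apply: (@le_trans _ _ (\sum_(1 <= k < n.+1) K * k%:R `^ (g - 1))).
  apply: (le_trans (ler_norm_sum _ _ _)); apply: ler_sum_nat => k /andP[k1 _].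
  apply: (le_trans (rt k k1)); rewrite ler_wpM2l// /N expr2 -powRD; last first.
    by rewrite pnatr_eq0 -lt0n k1 implybT.
  by rewrite (_ : - alpha + - alpha = g - 1)// /g; lra.
rewrite -mulr_sumr; apply: (@le_trans _ _ (K * (2 / g * n%:R `^ g))).
  by rewrite ler_wpM2l// sum_powR_le.
have -> : n%:R `^ b = n%:R `^ g * n%:R `^ alpha :> R.
  rewrite -powRD; last by rewrite (gt_eqF n0) implybT.
  by congr (_ `^ _); rewrite /g /b; lra.
have := ler_wpM2l (ltW e20) H2; rewrite mulrA divff ?gt_eqF// mul1r => H3.
by have := ler_wpM2r (powR_ge0 n%:R g) H3; lra.
Unshelve. all: by end_near. Qed.

End environment.

(** The inverse is [u] times a real power of [u^2]; at 0 both expressions vanish. *)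
Lemma measurable_invr (R : realType) : measurable_fun [set: R] (@GRing.inv R).
Proof.
rewrite (_ : GRing.inv = fun u : R => u * (u ^+ 2) `^ (-1)).
  apply: measurable_funM => //.
  apply: (@measurableT_comp _ _ _ _ _ _ (fun v : R => v `^ (-1))) => //;
    by [exact: measurable_powR|exact: exprn_measurable].
apply/funext => u; rewrite powR_inv1 ?sqr_ge0//.
have [->|u0] := eqVneq u 0; first by rewrite invr0 mul0r.
by rewrite expr2 invfM mulrA divff// mul1r.
Qed.

Lemma ae_probability1 d (T : measurableType d) (R : realType) (P : probability T R)
    (A : set T) (mA : measurable A) : P A = 1%E <-> {ae P, forall w, A w}.
Proof.
split=> [PA|].
  exists (~` A); split => //; first exact: measurableC.
  by have := probability_setC P mA; rewrite PA subee.
move=> /(@negligibleP _ _ _ P (~` A) (measurableC mA)) h.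
by have := probability_setC P (measurableC mA); rewrite setCK h sube0.
Qed.

(** * Almost sure asymptotics of the random environment *)

Section environment_ae.
Context (R : realType) (d : measure_display) (Omega : measurableType d).
Context (P : probability Omega R) (delta alpha : R).
Context (xi Y : nat -> {RV P >-> R}) (lambda : R).
Hypothesis hdelta : 0 < delta < 1 / 2.
Hypothesis halpha : 0 < alpha < 1 / 2.
Hypothesis hiid : iid P (fun i w => (xi i w, Y i w)).
Hypothesis hxi : P [set w | delta <= xi 1%N w <= 1 - delta] = 1%E.
Hypothesis hY : P [set w | -1 <= Y 1%N w <= 1] = 1%E.
Hypothesis hzeta : ('E_P[zeta xi 1%N] = 0)%E.
Hypothesis hlambdaE : ('E_P[Zvar xi Y 1%N] = lambda%:E)%E.

Let X i w := (xi i w, Y i w).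
Let mX i : measurable_fun setT (X i).
Proof. by apply: measurable_fun_pair; exact: measurable_funP. Qed.

Let D : set (R * R) := `[delta, 1 - delta]%classic `*` `[-1, 1]%classic.
Let mD : measurable D.
Proof. exact: measurableX. Qed.

Let DE u : D u -> delta <= u.1 <= 1 - delta /\ `|u.2| <= 1.
Proof. by move=> [/=]; rewrite !in_itv/= => -> h; split => //; rewrite ler_norml. Qed.

Lemma ae_environment_itv i : (1 <= i)%N -> {ae P, forall w, D (X i w)}.
Proof.
move=> i1; have mXD k : measurable (X k @^-1` D).
  by rewrite -[A in measurable A]setTI; exact: mX.
suff : P (X 1%N @^-1` D) = 1%E.
  by rewrite -(hiid.2 i D i1 mD) => /(ae_probability1 P (mXD i)).
apply/(ae_probability1 P (mXD 1%N)).
have mxi : measurable [set w | delta <= xi 1%N w <= 1 - delta].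
  rewrite (_ : [set _ | _] = xi 1%N @^-1` `[delta, 1 - delta]%classic).
    exact: measurable_funPTI.
  by apply/seteqP; split => w /=; rewrite in_itv.
have mY : measurable [set w | -1 <= Y 1%N w <= 1].
  rewrite (_ : [set _ | _] = Y 1%N @^-1` `[-1, 1]%classic).
    exact: measurable_funPTI.
  by apply/seteqP; split => w /=; rewrite in_itv.
have /(ae_probability1 P mxi) h1 := hxi; have /(ae_probability1 P mY) h2 := hY.
by apply: filterS2 h1 h2 => w /= h1 h2; split; rewrite /= in_itv.
Qed.

Let integrable_X k (h : R * R -> R) M : measurable_fun setT h ->
  (forall u, `|h u| <= M) -> P.-integrable setT (EFin \o (h \o X k)).
Proof.
move=> mh hM; apply: measurable_bounded_integrable => //.
- exact: le_lt_trans (probability_le1 P measurableT) (ltry 1).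
- exact: measurableT_comp.
- by exists M; split; [exact: num_real|move=> v Mv w _; exact: le_trans (hM _) (ltW Mv)].
Qed.

(** Both integrals are integrals of [f] against the common law of the pairs. *)
Lemma integral_iid (f : R * R -> R) (M : R) i : (1 <= i)%N -> measurable_fun setT f ->
  (forall u, `|f u| <= M) ->
  (\int[P]_w (f (X i w))%:E = \int[P]_w (f (X 1%N w))%:E)%E.
Proof.
move=> i1 mf fM.
have mEf : measurable_fun setT (EFin \o f) by exact/measurable_EFinP.
have H k : (\int[P]_w (f (X k w))%:E = \int[pushforward P (X k)]_y (EFin \o f) y)%E.
  exact: esym (integral_pushforward (mX k) mEf (integrable_X k mf fM) measurableT).
rewrite !H.
apply: eq_measure_integral => A mA _; exact: hiid.2.
Qed.

(** The indicator of [D] makes the functions bounded everywhere, as Chernoff's bound requires,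
    without changing them almost surely along the environment. *)
Let zf (u : R * R) : R := \1_D u * ln (u.1 / (1 - u.1)).
Let zg (u : R * R) : R := \1_D u * (u.2 / (u.1 * (1 - u.1))).

Let mln : measurable_fun setT (fun u : R * R => ln (u.1 / (1 - u.1))).
Proof.
apply: measurableT_comp; first exact: measurable_ln.
apply: measurable_funM; first exact: measurable_fst.
apply: measurableT_comp; first exact: measurable_invr.
by apply: measurable_funB => //; exact: measurable_fst.
Qed.

Let mZ : measurable_fun setT (fun u : R * R => u.2 / (u.1 * (1 - u.1))).
Proof.
apply: measurable_funM; first exact: measurable_snd.
apply: measurableT_comp; first exact: measurable_invr.
apply: measurable_funM; first exact: measurable_fst.
by apply: measurable_funB => //; exact: measurable_fst.
Qed.

Let mzf : measurable_fun setT zf.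
Proof. by apply: measurable_funM => //; exact: measurable_indic. Qed.

Let mzg : measurable_fun setT zg.
Proof. by apply: measurable_funM => //; exact: measurable_indic. Qed.

Let zf_bound u : `|zf u| <= delta^-1.
Proof.
have /andP[d0 _] := hdelta.
rewrite /zf indicE; have [|_] := boolP (u \in D); last first.
  by rewrite mul0r normr0 invr_ge0 ltW.
by rewrite inE mul1r => /DE[h _]; exact: norm_ln_odds_le.
Qed.

Let zg_bound u : `|zg u| <= (delta ^+ 2)^-1.
Proof.
have /andP[d0 d1] := hdelta; have d2 : 0 < delta ^+ 2 by rewrite exprn_gt0.
rewrite /zg indicE; have [|_] := boolP (u \in D); last first.
  by rewrite mul0r normr0 invr_ge0 ltW.
rewrite inE mul1r => /DE[/andP[u1 u2] h]; rewrite normrM normfV.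
have dx : delta ^+ 2 <= u.1 * (1 - u.1) by rewrite expr2 ler_pM//; lra.
have dx0 : 0 < u.1 * (1 - u.1) by exact: lt_le_trans dx.
by rewrite (gtr0_norm dx0) -[leRHS]mul1r ler_pM ?invr_ge0 ?(ltW dx0)// lef_pV2 ?posrE.
Qed.

Let Ezf i : (1 <= i)%N -> (\int[P]_w (zf (X i w))%:E = 0)%E.
Proof.
move=> i1; rewrite (integral_iid i1 mzf zf_bound) -hzeta unlock.
apply: ae_eq_integral => //.
- by apply/measurable_EFinP; exact: measurableT_comp mzf (mX 1%N).
- by apply/measurable_EFinP; exact: measurableT_comp mln (mX 1%N).
apply: filterS (ae_environment_itv (leqnn 1)) => w Dw _.
by rewrite /zf indicE mem_set// mul1r.
Qed.

Let Ezg i : (1 <= i)%N -> (\int[P]_w (zg (X i w))%:E = lambda%:E)%E.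
Proof.
move=> i1; rewrite (integral_iid i1 mzg zg_bound) -hlambdaE unlock.
apply: ae_eq_integral => //.
- by apply/measurable_EFinP; exact: measurableT_comp mzg (mX 1%N).
- by apply/measurable_EFinP; exact: measurableT_comp mZ (mX 1%N).
apply: filterS (ae_environment_itv (leqnn 1)) => w Dw _.
by rewrite /zg indicE mem_set// mul1r.
Qed.

Let f k u : R := zf u + (zg u - lambda) * k%:R `^ (- alpha).

Let mf k : measurable_fun setT (f k).
Proof.
apply: measurable_funD => //; apply: measurable_funM => //.
exact: measurable_funB.
Qed.

Let f_bound k u : `|f k u| <= delta^-1 + ((delta ^+ 2)^-1 + `|lambda|).
Proof.
have /andP[a0 _] := halpha.
apply: (le_trans (ler_normD _ _)); rewrite lerD// normrM -[leRHS]mulr1.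
apply: ler_pM => //; first by rewrite (le_trans (ler_normB _ _))// lerD.
rewrite ger0_norm ?powR_ge0//; case: k => [|k].
  by rewrite powR0// oppr_eq0 gt_eqF.
by rewrite -[leRHS](powRr0 (k.+1%:R : R)) ler_powR ?ler1n// oppr_le0 ltW.
Qed.

Let Ef k : (1 <= k)%N -> (\int[P]_w (f k (X k w))%:E = 0)%E.
Proof.
move=> k1.
set a := k%:R `^ (- alpha).
have -> : (\int[P]_w (f k (X k w))%:E =
    \int[P]_w ((zf (X k w))%:E + a%:E * ((zg (X k w))%:E + (- lambda)%:E)))%E.
  apply: eq_integral => w _.
  transitivity ((zf (X k w) + a * (zg (X k w) - lambda))%:E); last by [].
  by rewrite /f -/a (mulrC a).
have izg : P.-integrable setT (fun w => (zg (X k w))%:E + (- lambda)%:E)%E.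
  apply: integrableD => //; first exact: (integrable_X _ mzg zg_bound).
  exact: finite_measure_integrable_cst.
rewrite integralD//; last 2 first.
- exact: (integrable_X _ mzf zf_bound).
- exact: integrableZl.
rewrite Ezf// add0e integralZl// integralD//; last 2 first.
- exact: (integrable_X _ mzg zg_bound).
- exact: finite_measure_integrable_cst.
rewrite Ezg// integral_cst// [A in (_ + _ * A)%E](probability_setT P) mule1.
by rewrite -EFinD subrr mule0.
Qed.

Lemma ae_ln_odds_prod_env : {ae P, forall w, forall e : R, 0 < e ->
  \forall n \near \oo,
    `|ln (odds_prod (env delta alpha (xi ^~ w) (Y ^~ w)) n)
      - lambda / (1 - alpha) * n%:R `^ (1 - alpha)| <= e * n%:R `^ (1 - alpha)}.
Proof.
have /andP[_ a1] := halpha; have b12 : 1 / 2 < 1 - alpha by lra.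
have H1 := ae_sum_le_powR mX hiid.1 b12 mf f_bound Ef.
(* The one-sided estimate is repeated for [- f] to control the absolute value. *)
have mNf k : measurable_fun setT (\- f k) by exact: measurable_funN.
have Nf_bound k u : `|(\- f k) u| <= delta^-1 + ((delta ^+ 2)^-1 + `|lambda|).
  by rewrite /= normrN.
have ENf k : (1 <= k)%N -> (\int[P]_w ((\- f k) (X k w))%:E = 0)%E.
  move=> k1; under eq_integral do rewrite /= -mulN1r EFinM.
  by rewrite integralZl ?Ef ?mule0//; exact: (integrable_X _ (mf k) (f_bound k)).
have H2 := ae_sum_le_powR mX hiid.1 b12 mNf Nf_bound ENf.
have H3 : {ae P, forall w, forall i, D (X i.+1 w)}.
  by apply: ae_forall_nat => i; exact: ae_environment_itv.
apply: filterS3 H1 H2 H3 => w H1 H2 H3.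
have H4 k : (0 < k)%N -> delta <= xi k w <= 1 - delta /\ `|Y k w| <= 1.
  by case: k => // k _; exact: (DE (H3 k)).
apply: ln_odds_prod_env => //.
- by move=> k /H4[].
- by move=> k /H4[].
move=> e e0; apply: filterS2 (H1 e e0) (H2 e e0) => n.
rewrite sumrN => h1 h2.
rewrite (_ : \sum_(_ <= _ < _) _ = \sum_(1 <= i < n.+1) f i (X i w)).
  by rewrite ler_norml; apply/andP; split; lra.
apply: eq_big_nat => -[//|k] _; have Dk := H3 k.
by rewrite /f /zf /zg indicE mem_set// !mul1r.
Qed.

End environment_ae.

(** * From the quenched bounds to the logarithmic rate *)

Unset Implicit Arguments.

Theorem theorem5 (R : realType) (d : measure_display) (Omega : measurableType d)
  (P : probability Omega R) (delta alpha : R)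
  (xi Y : nat -> {RV P >-> R}) (r : nat) (lambda : R)
  (hdelta : 0 < delta < 1 / 2)
  (halpha : 0 < alpha < 1 / 2)
  (hiid : iid P (fun i w => (xi i w, Y i w)))
  (hxi : P [set w | delta <= xi 1%N w <= 1 - delta] = 1%E)
  (hY : P [set w | -1 <= Y 1%N w <= 1] = 1%E)
  (hzeta : ('E_P[zeta xi 1%N] = 0)%E)
  (hs : (0 < 'V_P[xi 1%N] < +oo)%E)
  (hlambdaE : ('E_P[Zvar xi Y 1%N] = lambda%:E)%E)
  (hlambda : 0 < lambda)
  (hsigma : (0 <= 'V_P[Y 1%N] < +oo)%E) :
  {ae P, forall w : Omega,
    forall (d' : measure_display) (S : measurableType d')
      (Q : probability S R) (eta : nat -> {RV Q >-> nat}),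
      quenched_walk (env delta alpha (xi ^~ w) (Y ^~ w)) r eta ->
      forall eps : R, 0 < eps ->
        {ae Q, forall v : S,
          finite_set (~` [set t : nat |
            (eta t v)%:R <= (1 + eps) * rate alpha lambda t]) /\
          infinite_set [set t : nat |
            (1 - eps) * rate alpha lambda t <= (eta t v)%:R]}}.
Proof.
have /andP[d0 d1] := hdelta; have /andP[a0 a1] := halpha.
apply: filterS (ae_ln_odds_prod_env hdelta halpha hiid hxi hY hzeta hlambdaE) => w Hw.
move=> d' S Q eta walk eps eps0.
set p := env _ _ _ _ in Hw walk; set b : R := 1 - alpha in Hw.
have b0 : 0 < b by rewrite /b; lra.
have bi0 : 0 < b^-1 by rewrite invr_gt0.
set c := lambda / b in Hw; have c0 : 0 < c by rewrite divr_gt0.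
have kappa0 : 0 < delta / 2 by lra.
have p0 n : 0 < p n by have /andP[h _] := env_itv alpha (xi ^~ w) (Y ^~ w) hdelta n; exact: lt_le_trans h.
have pk n : p n <= 1 - delta / 2 by have /andP[] := env_itv alpha (xi ^~ w) (Y ^~ w) hdelta n.
(* Chosen so that the root of order [b] of [1 + theta] is exactly [1 + eps]. *)
pose theta := (1 + eps) `^ b - 1.
have theta0 : 0 < theta.
  have E1 : 1 `^ b = 1 :> R by rewrite powR1.
  rewrite subr_gt0 -[ltLHS]E1 gt0_ltr_powR ?nnegrE//; lra.
have thetaE : 1 + theta = (1 + eps) `^ b by rewrite addrC subrK.
have root (u : R) : 0 <= u -> (u `^ b) `^ b^-1 = u.
  by move=> u0; rewrite -powRrM divff ?gt_eqF// powRr1.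
have ln0n (t : nat) : 0 <= ln (t%:R : R).
  by case: t => [|t]; [rewrite ln0|rewrite ln_ge0// ler1n].
have rateE t : rate alpha lambda t = (c^-1 * ln t%:R) `^ b^-1.
  by rewrite /rate -powRM ?invf_div// divr_ge0// ltW.
have rate0 t : 0 <= rate alpha lambda t by rewrite rateE powR_ge0.
have rate_pow t : (1 + eps) * rate alpha lambda t =
    (c^-1 * ((1 + theta) * ln t%:R)) `^ b^-1.
  rewrite thetaE rateE (mulrCA c^-1) [RHS]powRM ?powR_ge0//; last first.
    by rewrite mulr_ge0// invr_ge0 ltW.
  by rewrite root//; lra.
have upper := quenched_upper_bound kappa0 p0 pk b0 c0 Hw walk theta0.
have lower := quenched_lower_bound kappa0 p0 pk b0 c0 Hw walk theta0.
apply: filterS2 upper lower => v upper lower; split.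
  case: upper => N _ HN; apply: (@sub_finite_set _ _ `I_N); last exact: finite_II.
  move=> t /=; apply: contra_notP => /negP; rewrite -leqNgt => /HN /= Ht.
  rewrite rate_pow -[leLHS]root//; apply: ge0_ler_powR; rewrite ?nnegrE ?powR_ge0 ?(ltW bi0)//.
    by rewrite !mulr_ge0 ?invr_ge0 ?(ltW c0)//; lra.
  by rewrite ler_pdivlMl.
apply: sub_infinite_set lower => t /= Ht.
have h : rate alpha lambda t <= (1 + eps) * (eta t v)%:R.
  rewrite rateE -[leRHS]root; last by rewrite mulr_ge0//; lra.
  apply: ge0_ler_powR; rewrite ?nnegrE ?powR_ge0 ?(ltW bi0)//.
    by rewrite mulr_ge0// invr_ge0 ltW.
  rewrite ler_pdivrMl// powRM//; last lra.
  by rewrite -thetaE mulrCA.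
(* For [eps >= 1] the left-hand side is nonpositive; otherwise [h] is multiplied by [1 - eps] and
   [(1 - eps) * (1 + eps) <= 1] concludes. *)
have [e1|e1] := leP 1 eps.
  apply: (@le_trans _ _ 0) => //; rewrite mulr_le0_ge0//; lra.
apply: (@le_trans _ _ ((1 - eps) * ((1 + eps) * (eta t v)%:R))).
  by rewrite ler_wpM2l//; lra.
rewrite mulrA ler_piMl//; have : 0 <= eps ^+ 2 by exact: sqr_ge0.
have -> : (1 - eps) * (1 + eps) = 1 - eps ^+ 2 by ring.
lra.
Qed.
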